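(* As functions of $n$, the number of $n$-square square-tiled surfaces in $\mathcal H(2)$ is $\Theta(n^3)$, while the number of $n$-square square-tiled surfaces in $\mathcal H(2)$ that have a unit saddle is $\Theta(n^2)$.
   Context: A square-tiled surface with $n$ squares is a connected translation surface obtained from $n$ unit squares (with horizontal and vertical sides) by gluing sides in parallel opposite pairs by translations; surfaces are considered up to translation equivalence (cut and paste). Equivalently it is a pair $(\sigma,\tau)\in S_n\times S_n$ (right-gluing and up-gluing) generating a transitive group, up to simultaneous conjugation. $\mathcal H(2)$ is the stratum of translation surfaces of genus two having exactly one cone point, of angle $6\pi$, and flat elsewhere. A saddle connection is a straight geodesic segment whose endpoints are cone points and which has no cone points in its interior. A unit saddle is a saddle connection of length one. $f(n)=\Theta(h(n))$ means that there are constants $c,C>0$ and $n_0\in\mathbb N$ with $c\,h(n)\le f(n)\le C\,h(n)$ for all $n\ge n_0$. *)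

(* Defs.v *)
From Stdlib Require Import Relation_Operators.
From HB Require Import structures.
From mathcomp Require Import all_boot all_order all_algebra all_fingroup.
From mathcomp Require Import all_classical all_reals all_analysis.
Set Implicit Arguments.
Unset Strict Implicit.
Unset Printing Implicit Defensive.
Import Order.TTheory GRing.Theory Num.Theory.
Local Open Scope ring_scope.

(* The pair (right-gluing, up-gluing): the right side of square [i] is glued to
   the left side of square [o.1 i], and its top side to the bottom side of
   square [o.2 i]. *)
Definition gluing (n : nat) : Type := ({perm 'I_n} * {perm 'I_n})%type.

Definition connected_gluing (n : nat) (o : gluing n) : bool :=
  [transitive <<[set o.1; o.2]>>%g, on [set: 'I_n] | 'P]%act.

(* [(i, (x, y))] is the point with coordinates (x, y) in the closed unit square
   [i]; a point of the surface is a class of such triples for [same_point]. *)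
Definition sq_point (R : realType) (n : nat) : Type := ('I_n * (R * R))%type.

Definition in_square (R : realType) (n : nat) (p : sq_point R n) : bool :=
  (0 <= p.2.1 <= 1) && (0 <= p.2.2 <= 1).

Inductive glued (R : realType) (n : nat) (o : gluing n) :
    sq_point R n -> sq_point R n -> Prop :=
| glued_right (i : 'I_n) (y : R) : 0 <= y <= 1 ->
    glued o (i, (1, y)) (o.1 i, (0, y))
| glued_up (i : 'I_n) (x : R) : 0 <= x <= 1 ->
    glued o (i, (x, 1)) (o.2 i, (x, 0)).

Definition same_point (R : realType) (n : nat) (o : gluing n) :
    sq_point R n -> sq_point R n -> Prop :=
  clos_refl_sym_trans (sq_point R n) (@glued R n o).

(* The angle that the square itself subtends at one of its points: 2 pi in the
   interior, pi inside a side, pi / 2 at a corner. *)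
Definition sq_angle (R : realType) (n : nat) (p : sq_point R n) : R :=
  let factor (x : R) : R := if (x == 0) || (x == 1) then 2^-1 else 1 in
  factor p.2.1 * factor p.2.2 * (2 * pi).

(* The sum ranges over the finitely many representatives of the point: gluing
   only ever changes a coordinate between 0 and 1. *)
Definition total_angle (R : realType) (n : nat) (o : gluing n)
    (p : sq_point R n) : R :=
  \sum_(q \in [set q : sq_point R n | same_point o p q]%classic) sq_angle q.

Definition cone_point (R : realType) (n : nat) (o : gluing n)
    (p : sq_point R n) : Prop :=
  in_square p /\ total_angle o p <> 2 * pi.

Definition corner (R : realType) (n : nat) (c : 'I_n * (bool * bool)) :
    sq_point R n :=
  (c.1, ((c.2.1)%:R, (c.2.2)%:R)).

Definition num_vertices (R : realType) (n : nat) (o : gluing n) : nat :=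
  #|equivalence_partition
      [rel c d | `[< same_point o (corner R c) (corner R d) >]]
      [set: 'I_n * (bool * bool)]|.

(* Vertices - edges + faces of the square cell structure; the [4 n] sides of
   the squares are identified in pairs. *)
Definition euler_characteristic (R : realType) (n : nat) (o : gluing n) : int :=
  (num_vertices R o)%:Z - (2 * n)%:Z + n%:Z.

Definition has_genus (R : realType) (n : nat) (o : gluing n) (g : nat) : Prop :=
  euler_characteristic R o = 2 - 2 * g%:Z.

Definition in_H2 (R : realType) (n : nat) (o : gluing n) : Prop :=
  [/\ connected_gluing o,
      has_genus R o 2 &
      exists p : sq_point R n,
        [/\ cone_point o p,
            total_angle o p = 6 * pi &
            forall q : sq_point R n, cone_point o q -> same_point o p q]].

Definition shift (R : realType) (n : nat) (p : sq_point R n) (u v s : R) :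
    sq_point R n :=
  (p.1, (p.2.1 + s * u, p.2.2 + s * v)).

(* [g] restricted to [0, L] is a path on the surface with constant velocity
   (u, v): just after and just before each time it runs inside a single closed
   square, where it is an affine segment.  Between cone points a geodesic of a
   translation surface keeps a constant direction, and at a point of angle 2 pi
   the outgoing ray of direction (u, v) is unique, so away from cone points this
   is the same as being a straight geodesic. *)
Definition straight_path (R : realType) (n : nat) (o : gluing n)
    (u v L : R) (g : R -> sq_point R n) : Prop :=
  (forall t : R, 0 <= t < L ->
     exists (e : R) (p : sq_point R n), 0 < e /\
       forall s : R, 0 <= s <= e ->
         in_square (shift p u v s) /\ same_point o (g (t + s)) (shift p u v s))
  /\
  (forall t : R, 0 < t <= L ->
     exists (e : R) (p : sq_point R n), 0 < e /\
       forall s : R, - e <= s <= 0 ->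
         in_square (shift p u v s) /\ same_point o (g (t + s)) (shift p u v s)).

(* The velocity is a unit vector, so [L] is the length. *)
Definition saddle_connection (R : realType) (n : nat) (o : gluing n)
    (L : R) (g : R -> sq_point R n) : Prop :=
  0 < L /\
  exists u v : R,
    [/\ u ^+ 2 + v ^+ 2 = 1,
        straight_path o u v L g,
        cone_point o (g 0),
        cone_point o (g L) &
        forall t : R, 0 < t < L -> ~ cone_point o (g t)].

Definition has_unit_saddle (R : realType) (n : nat) (o : gluing n) : Prop :=
  exists g : R -> sq_point R n, saddle_connection o 1 g.

Definition relabelings (n : nat) (o : gluing n) : {set gluing n} :=
  [set ((o.1 ^ s)%g, (o.2 ^ s)%g) | s : {perm 'I_n}].

(* A square-tiled surface is a gluing up to relabeling of its squares. *)
Definition num_surfaces (n : nat) (P : gluing n -> Prop) : nat :=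
  #|[set relabelings o | o in [set o : gluing n | `[< P o >]]]|.

Definition Theta (R : realType) (f h : nat -> R) : Prop :=
  exists (c C : R) (n0 : nat), [/\ 0 < c, 0 < C &
    forall n : nat, (n0 <= n)%N -> c * h n <= f n /\ f n <= C * h n].

(* Main.v *)
Require Import Defs.
From Stdlib Require Import Relation_Operators.
From mathcomp Require Import all_boot all_order all_algebra all_fingroup.
From mathcomp Require Import all_classical all_reals all_analysis.
From mathcomp Require Import zify ring lra.
Set Implicit Arguments.
Unset Strict Implicit.
Unset Printing Implicit Defensive.

(** Write s and t for the two gluing permutations, and attach to a square its
    lower left corner.  Turning once around that corner moves the square by the
    commutator [~ s, t], so the vertices of the surface are the cycles of the
    commutator and a cycle of length m carries the angle 2 m pi.  Hence the
    surface lies in H(2) exactly when the group is transitive and the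
    commutator moves exactly three squares; being free of fixed points on
    these three, it permutes them cyclically, and the Euler characteristic
    (n - 2) - 2 n + n = - 2 is then automatic ([in_H2E]).

    The holonomy of a path from cone point to cone point is integral, so a unit
    saddle has direction (+-1, 0) or (0, +-1), and it follows one side of a
    square: some moved square has its right or its upper neighbour moved too
    ([unit_saddle_has_unit], [unit_has_unit_saddle]).

    Upper bounds.  Cut the surface along the three horizontal saddle
    connections.  They run along the bottoms of the moved squares, and the
    orders in which they follow each other seen from above and seen from below
    differ by the commutator.  Comparing the widths of the cylinders at their
    two ends leaves two patterns ([diagram_classification]): one cylinder of
    circumference l0 + l1 + l2, or two cylinders of circumferences
    l2 < l0 + l2.  The lengths, heights and twists determine the surface up to
    relabeling ([realizes_conj]), and the areas of the cylinders add up to n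
    ([realizes_card]).  The choices are then counted by sums bounded, up to a
    constant, by n^3 sum 1/H^2 in general, and by n^2 sum 1/H^2 when some length
    is 1; vertical unit saddles reduce to horizontal ones by exchanging s
    and t.

    Lower bounds.  Take for s a fixed n-cycle c.  If x, y, z are such that
    tperm x z * tperm x y * c is again an n-cycle, then c is conjugate to it by n
    permutations t, and [~ c, t] is a 3-cycle supported on c x, c y, c z.  Since
    the centralizer of c has n elements, the number of surfaces so obtained is
    at least a third of the number of triples ([lower_family]).  About half of
    all triples qualify, and so do nearly all triples with x = c y, which force a
    unit saddle. *)

(** * Surfaces determined by a separatrix diagram *)

Section PermIter.
Variables (T : finType) (s : {perm T}).

Lemma iter_perm_inj m : injective (iter m s).
Proof. by elim: m => [|m IH] x y //= /perm_inj /IH. Qed.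

Lemma iter_period : exists2 N, (0 < N)%N & forall x, iter N s x = x.
Proof.
exists #[s]%g; first exact: order_gt0.
by move=> x; rewrite -permX expg_order perm1.
Qed.

Lemma iter_back x m : exists m', iter m' s (iter m s x) = x.
Proof.
have [N N0 HN] := iter_period.
exists (m * N - m)%N; rewrite -iterD subnK; last by rewrite leq_pmulr.
by elim: m => [|m IH] //=; rewrite mulSn iterD IH HN.
Qed.

Lemma iter_cross x y m1 m2 : iter m1 s x = iter m2 s y ->
  exists m, x = iter m s y.
Proof.
move=> e; have [m' hm] := iter_back x m1.
by exists (m' + m2)%N; rewrite iterD -e hm.
Qed.

Lemma iterC x m1 m2 : iter m1 s (iter m2 s x) = iter m2 s (iter m1 s x).
Proof. by rewrite -!iterD addnC. Qed.

Lemma iter_fix_row x m W : (iter W s (iter m s x) == iter m s x) = (iter W s x == x).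
Proof. by rewrite iterC (inj_eq (@iter_perm_inj m)). Qed.

Lemma iter_modn x m W : iter W s x = x -> iter (m %% W) s x = iter m s x.
Proof.
move=> e; rewrite {2}(divn_eq m W) addnC iterD; congr iter.
by elim: (m %/ W) => [|k IH] //=; rewrite mulSn iterD -IH.
Qed.

End PermIter.

(** Induction along words in the two generators of a transitive group: the
    points satisfying the property form a union of orbits. *)
Lemma transitive_ind (T : finType) (s t : {perm T}) (A : T -> Prop) x0 :
  [transitive <<[set s; t]>>%g, on [set: T] | 'P]%act ->
  A x0 -> (forall x, A x -> A (s x)) -> (forall x, A x -> A (t x)) ->
  forall x, A x.
Proof.
move=> tr A0 As At x.
pose B := [set x | `[< A x >]].
have st1 (u : {perm T}) : (forall x, A x -> A (u x)) -> u \in 'N(B | 'P)%g.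
  move=> Au; rewrite inE finset.in_setT /= inE.
  by apply/fintype.subsetP => y; rewrite !inE /= /aperm => Ay; exact: Au.
have st : (<<[set s; t]>> \subset 'N(B | 'P)%g)%g.
  rewrite gen_subG; apply/fintype.subsetP => u /set2P [] ->; exact: st1.
have B0 : x0 \in B by rewrite inE; apply/asboolP.
have /fintype.subsetP sub : orbit 'P%act <<[set s; t]>>%g x0 \subset B.
  by rewrite acts_sub_orbit.
have [a aG e] := atransP2 tr (finset.in_setT x0) (finset.in_setT x).
have /sub : x \in orbit 'P%act <<[set s; t]>>%g x0.
  by rewrite e; exact: mem_orbit.
by rewrite !inE.
Qed.

(** The saddle connections are numbered.  Above saddle i lies a strip of squares
    of width [len i], which belongs to a cylinder of [(height i).+1] rows; the
    strip to its right in that cylinder lies above saddle [next_right i].  Seen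
    from below, saddle i is followed by saddle [next_top i].  The twist of the
    cylinder is recorded by its top row: going up from the first square of strip
    i one meets the square found [offset i] steps to the right of the one below
    the start of saddle [target i]. *)
Record diagram := Diagram {
  next_right : nat -> nat; next_top : nat -> nat; target : nat -> nat;
  len : nat -> nat; height : nat -> nat; offset : nat -> nat }.

Definition wf_diagram r D := forall i, (i < r)%N ->
  [/\ (next_right D i < r)%N, (next_top D i < r)%N, (target D i < r)%N,
      (0 < len D i)%N & height D (next_right D i) = height D i].

Section Realizes.
Variable T : finType.

(** The square [p i] has the start of saddle i as its lower left corner.  As
    strip i starts with [p i], the square [iter y t (iter m s (p i))] is the one
    in row y and column m of its cylinder. *)
Record realizes (r : nat) (D : diagram) (s t : {perm T}) (p : nat -> T) : Prop :=
 Realizes {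
  r_right : forall i, (i < r)%N -> iter (len D i) s (p i) = p (next_right D i);
  r_below : forall i m, (i < r)%N -> (m < len D i)%N ->
    t (iter m s (t^-1%g (p i))) = iter m s (p i);
  r_top : forall i, (i < r)%N ->
    iter (len D i) s (t^-1%g (p i)) = t^-1%g (p (next_top D i));
  r_comm : forall i y m, (i < r)%N -> (y <= height D i)%N ->
    iter y t (iter m s (p i)) = iter m s (iter y t (p i));
  r_glue : forall i, (i < r)%N ->
    iter (height D i) t (p i) = iter (offset D i) s (t^-1%g (p (target D i)));
  r_inj : forall i j x y x' y', (i < r)%N -> (j < r)%N ->
    (x < len D i)%N -> (x' < len D j)%N ->
    (y <= height D i)%N -> (y' <= height D j)%N ->
    iter y t (iter x s (p i)) = iter y' t (iter x' s (p j)) ->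
    [/\ i = j, x = x' & y = y'] }.

(** The correspondence between two realizations of one diagram, squares with the
    same address being matched.  The column m is not bounded by the width of the
    strip, so that stability under right neighbours needs no case distinction;
    [matched_reduced] brings m back into range. *)
Definition matched r D (s t : {perm T}) p (s' t' : {perm T}) p' (a b : T) :=
  exists i y m, [/\ (i < r)%N, (y <= height D i)%N,
    a = iter y t (iter m s (p i)) & b = iter y t' (iter m s' (p' i))].

Variables (r : nat) (D : diagram).
Hypothesis wf : wf_diagram r D.

Section Pair.
Variables (s t : {perm T}) (p : nat -> T) (s' t' : {perm T}) (p' : nat -> T).
Hypothesis re : realizes r D s t p.
Hypothesis re' : realizes r D s' t' p'.
Local Notation Z := (matched r D s t p s' t' p').

Lemma matched_reduced a b : Z a b -> exists i y m,
  [/\ (i < r)%N, (y <= height D i)%N, (m < len D i)%N,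
    a = iter y t (iter m s (p i)) & b = iter y t' (iter m s' (p' i))].
Proof.
case=> i [y [m [ir yh ea eb]]].
have [n] := ubnP m; elim: n => // n IH in m i ir yh ea eb *; rewrite ltnS => mn.
case: (ltnP m (len D i)) => [lt|ge]; first by exists i, y, m.
have [h1 h2 h3 h4 h5] := wf ir.
apply: (IH (m - len D i)%N (next_right D i)) => //; last by lia.
- by rewrite h5.
- by rewrite -(r_right re ir) -iterD subnK.
- by rewrite -(r_right re' ir) -iterD subnK.
Qed.

Lemma matched_right a b : Z a b -> Z (s a) (s' b).
Proof.
case=> i [y [m [ir yh -> ->]]]; exists i, y, m.+1; split=> //.
  by rewrite (r_comm re) // -iterS -(r_comm re).
by rewrite (r_comm re') // -iterS -(r_comm re').
Qed.

(** Immediately above the line carrying the saddles, the squares are met in the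
    order prescribed by [next_top], in both realizations alike. *)
Lemma matched_up_row i m : (i < r)%N ->
  Z (t (iter m s (t^-1%g (p i)))) (t' (iter m s' (t'^-1%g (p' i)))).
Proof.
have [n] := ubnP m; elim: n => // n IH in m i *; rewrite ltnS => mn ir.
case: (ltnP m (len D i)) => [lt|ge].
  rewrite (r_below re) // (r_below re') //.
  by exists i, 0%N, m.
have [h1 h2 h3 h4 h5] := wf ir.
have := IH (m - len D i)%N (next_top D i).
rewrite -(r_top re ir) -(r_top re' ir) -!iterD subnK //; apply => //; lia.
Qed.

Lemma matched_up a b : Z a b -> Z (t a) (t' b).
Proof.
case=> i [y [m [ir yh -> ->]]].
case: (ltnP y (height D i)) => [lt|ge]; first by exists i, y.+1, m.
have {yh ge} -> : y = height D i by lia.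
rewrite (r_comm re) // (r_comm re') // (r_glue re) // (r_glue re') //.
rewrite -!iterD; apply: matched_up_row.
by case: (wf ir).
Qed.

Lemma matched_total : (0 < r)%N -> [transitive <<[set s; t]>>%g, on [set: T] | 'P]%act ->
  forall a, exists b, Z a b.
Proof.
move=> r0 tr; apply: (@transitive_ind _ s t _ (p 0) tr).
- by exists (p' 0), 0%N, 0%N, 0%N.
- by move=> x [b /matched_right]; exists (s' b).
- by move=> x [b /matched_up]; exists (t' b).
Qed.

Lemma matched_fun a b b' : Z a b -> Z a b' -> b = b'.
Proof.
move=> /matched_reduced [i [y [m [ir yh ml ea ->]]]].
move=> /matched_reduced [j [y' [m' [jr yh' ml' ea' ->]]]].
by have [] := r_inj re ir jr ml ml' yh yh' (esym (etrans (esym ea') ea)) => -> -> ->.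
Qed.

End Pair.

Lemma matched_sym (s t : {perm T}) p (s' t' : {perm T}) p' a b :
  matched r D s t p s' t' p' a b -> matched r D s' t' p' s t p b a.
Proof. by case=> i [y [m [ir yh ea eb]]]; exists i, y, m. Qed.

(** The correspondence is stable under both generators, so by transitivity it
    relates every square to some square, and uniqueness of reduced addresses
    makes it a bijection. *)
Theorem realizes_conj (s t : {perm T}) p (s' t' : {perm T}) p' : (0 < r)%N ->
  [transitive <<[set s; t]>>%g, on [set: T] | 'P]%act ->
  realizes r D s t p -> realizes r D s' t' p' ->
  exists f : {perm T}, s' = (s ^ f)%g /\ t' = (t ^ f)%g.
Proof.
move=> r0 tr re re'.
have /fin_all_exists [f Zf] := matched_total re re' r0 tr.
have finj : injective f.
  move=> a a' e; apply: (matched_fun re' re (matched_sym (Zf a))).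
  by rewrite e; apply: matched_sym.
exists (perm finj); split; apply/permP => x.
  rewrite -(permKV (perm finj) x) permJ !permE.
  apply: (matched_fun re re' (matched_right re re' (Zf _)) (Zf _)).
rewrite -(permKV (perm finj) x) permJ !permE.
apply: (matched_fun re re' (matched_up re re' (Zf _)) (Zf _)).
Qed.

(** Every square has exactly one reduced address. *)
Theorem realizes_card (s t : {perm T}) p : (0 < r)%N ->
  [transitive <<[set s; t]>>%g, on [set: T] | 'P]%act ->
  realizes r D s t p ->
  #|T| = (\sum_(0 <= i < r) len D i * (height D i).+1)%N.
Proof.
move=> r0 tr re.
pose L := [seq iter c.2 t (iter c.1 s (p i)) | i <- iota 0 r,
  c <- [seq (x, y) | x <- iota 0 (len D i), y <- iota 0 (height D i).+1]].
have uL : uniq L.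
  apply: allpairs_uniq_dep; first exact: iota_uniq.
    move=> i _; apply: allpairs_uniq; try exact: iota_uniq.
    by case=> ? ? [? ?] _ _ /= [-> ->].
  move=> u v /allpairsPdep [i [c [ir /allpairsP [[x y] [xl yl ->]] ->]]].
  move=> /allpairsPdep [j [d [jr /allpairsP [[x' y'] [xl' yl' ->]] ->]]] /=.
  move: ir xl yl jr xl' yl'; rewrite !mem_iota /= !add0n !ltnS.
  move=> ir xl yl jr xl' yl' /(r_inj re ir jr xl xl' yl yl') [-> -> ->] //.
have fL : L =i predT.
  move=> x; rewrite inE.
  have [b /(matched_reduced re re) [i [y [m [ir yh ml -> _]]]]] :=
    matched_total re re r0 tr x.
  apply/allpairsPdep; exists i, (m, y); split=> //; first by rewrite mem_iota.
  by apply/allpairsP; exists (m, y); rewrite !mem_iota /= !add0n ltnS.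
rewrite -(eq_card fL) (card_uniqP uL) size_allpairs_dep sumnE big_map.
rewrite /index_iota subn0; apply: eq_bigr => i _.
by rewrite size_allpairs !size_iota.
Qed.

End Realizes.

(** * The horizontal cylinders of a surface in H(2) *)

(** One cylinder with bottom 0, 1, 2 and top 0, 2, 1, in cyclic order.  The twist
    k is that of strip 0, and the other strips see it shifted by their position
    in the bottom. *)
Definition one_cyl l0 l1 l2 h k := Diagram
  (nth 0 [:: 1; 2; 0]) (nth 0 [:: 2; 0; 1]) (fun=> 0)
  (nth 0 [:: l0; l1; l2]) (fun=> h) (nth 0 [:: k; k + l0; k + l0 + l1])%N.

(** The large cylinder has bottom 0, 1 and top 0, 2; the small one has bottom 2
    and top 1, which is why saddles 1 and 2 have the same length. *)
Definition two_cyl l0 l2 h0 h2 k0 k2 := Diagram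
  (nth 0 [:: 1; 0; 2]) (nth 0 [:: 2; 1; 0]) (nth 0 [:: 0; 0; 1])
  (nth 0 [:: l0; l2; l2]) (nth 0 [:: h0; h0; h2]) (nth 0 [:: k0; k0 + l0; k2])%N.

(** The squares whose lower left corner is a cone point, see [cone_origin]. *)
Definition sing (T : finType) (s t : {perm T}) : {set T} :=
  [set x | [~ s, t]%g x != x].

Section Sing.
Variables (T : finType) (s t : {perm T}).
Local Notation turn := [~ s, t]%g.
Local Notation P := (sing s t).

Lemma turnE x : turn (s (t x)) = t (s x).
Proof. by rewrite /commg /conjg !permM !permK. Qed.

Lemma sing_turn x : (turn x \in P) = (x \in P).
Proof. by rewrite !inE (inj_eq perm_inj). Qed.

Lemma notin_sing x : x \notin P -> turn x = x.
Proof. by rewrite inE negbK => /eqP. Qed.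

(** Around a regular corner, going right then up is the same as going up then
    right. *)
Lemma sq_comm x : t (s x) \notin P -> t (s x) = s (t x).
Proof. by rewrite -turnE sing_turn => /notin_sing. Qed.

(** First return of the bottom line of a singular square to a cone point. *)
Definition saddle_lengths (l : T -> nat) := forall p, p \in P ->
  [/\ (0 < l p)%N, iter (l p) s p \in P &
      forall m, (0 < m < l p)%N -> iter m s p \notin P].

(** Number of rows to climb before the top line of the row meets a cone point. *)
Definition cyl_heights (h : T -> nat) := forall p, p \in P ->
  (exists m, t (iter m s (iter (h p) t p)) \in P) /\
  (forall y m, (y < h p)%N -> t (iter m s (iter y t p)) \notin P).

Lemma saddle_lengths_ex : exists l, saddle_lengths l.
Proof.
apply: (@fin_all_exists _ (fun=> nat) (fun p l => p \in P ->
  [/\ (0 < l)%N, iter l s p \in P &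
      forall m, (0 < m < l)%N -> iter m s p \notin P])) => p.
case pP: (p \in P); last by exists 0.
have [N N0 HN] := iter_period s.
have ex : exists m, (0 < m)%N && (iter m s p \in P) by exists N; rewrite N0 HN.
exists (ex_minn ex) => _; case: ex_minnP => m /andP[m0 mP] min; split=> //.
by move=> m' /andP[m'0 lt]; apply: contraTN lt => m'P; rewrite -leqNgt min ?m'0.
Qed.

Lemma cyl_heights_ex : exists h, cyl_heights h.
Proof.
apply: (@fin_all_exists _ (fun=> nat) (fun p h => p \in P ->
  (exists m, t (iter m s (iter h t p)) \in P) /\
  (forall y m, (y < h)%N -> t (iter m s (iter y t p)) \notin P))) => p.
case pP: (p \in P); last by exists 0.
have [N N0 HN] := iter_period t.
have ex : exists y, `[< exists m, t (iter m s (iter y t p)) \in P >].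
  (* Going all the way around upwards, one arrives just below p. *)
  exists N.-1; apply/asboolP; exists 0.
  by rewrite /= -iterS prednK // HN.
exists (ex_minn ex) => _; case: ex_minnP => h /asboolP hP min; split=> // y m lt.
apply: contraTN lt => yP; rewrite -leqNgt min //; apply/asboolP; by exists m.
Qed.

(** A horizontal saddle connection of length one along the bottom of a square. *)
Definition has_unit := exists2 p, p \in P & s p \in P.

Section Saddles.
Variables (l h : T -> nat).
Hypotheses (lP : saddle_lengths l) (hP : cyl_heights h).
Local Notation al p := (iter (l p) s p).

Lemma saddle_next_uniq p p' x x' : p \in P -> p' \in P ->
  (x < l p)%N -> (x' < l p')%N -> iter x s p = iter x' s p' -> p = p' /\ x = x'.
Proof.
wlog le : p p' x x' / (x <= x')%N => [wl|] pP pP' xl xl' e.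
  case: (leqP x x') => [le|/ltnW le]; first exact: wl.
  by have [] := wl p' p x' x le pP' pP xl' xl (esym e).
have [_ _ minl] := lP pP'.
have {e}e : p = iter (x' - x) s p'.
  apply: (@iter_perm_inj _ s x); rewrite e -iterD; congr iter; lia.
have d0 : (x' - x = 0)%N.
  apply/eqP; rewrite -leqn0 leqNgt; apply/negP => d0.
  have /negP[] := minl (x' - x)%N ltac:(lia).
  by rewrite -e.
by split; [rewrite e d0 | lia].
Qed.

Lemma below_saddle p m : p \in P -> (m < l p)%N ->
  t (iter m s (t^-1%g p)) = iter m s p.
Proof.
move=> pP; elim: m => [|m IH] lt; first by rewrite permKV.
have e : t (iter m s (t^-1%g p)) = iter m s p by apply: IH; lia.
have [_ _ minl] := lP pP.
have nP : iter m.+1 s p \notin P by apply: minl; lia.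
rewrite /= -turnE e; exact: (notin_sing nP).
Qed.

(** At the end of a saddle, the continuations along its upper side and along its
    lower side differ by one turn around the cone point: this is how the
    commutator relates [next_right] and [next_top]. *)
Lemma end_saddle p : p \in P ->
  iter (l p) s (t^-1%g p) = t^-1%g (turn (al p)).
Proof.
move=> pP; have [l0 _ minl] := lP pP.
rewrite -(prednK l0) /=; set m := (l p).-1.
have e : t (iter m s (t^-1%g p)) = iter m s p.
  by apply: below_saddle => //; rewrite /m; lia.
by rewrite -e turnE permK.
Qed.

(** No cone point occurs on the lines between the rows of a cylinder, so the rows
    are glued without shear. *)
Lemma cyl_comm p y m : p \in P -> (y <= h p)%N ->
  iter y t (iter m s p) = iter m s (iter y t p).
Proof.
move=> pP; have [_ minh] := hP pP.
elim: y => [|y IH] // lt; rewrite iterS IH; last lia.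
rewrite iterS; elim: m {IH} => [|m IHm] //=.
rewrite -IHm; apply: sq_comm; rewrite -iterS; exact: minh.
Qed.

(** The bottom and top boundaries of a cylinder have the same periods. *)
Lemma cyl_width p W m q : p \in P -> iter (h p) t p = iter m s q ->
  (iter W s q == q) = (iter W s p == p).
Proof.
move=> pP e; rewrite -(iter_fix_row _ _ m) -e -cyl_comm //.
exact: (inj_eq (@iter_perm_inj _ t _)).
Qed.

Lemma cyl_height_next p : p \in P -> h (al p) = h p.
Proof.
move=> pP; have [_ aP _] := lP pP.
have [[m1 h1] min1] := hP pP; have [[m2 h2] min2] := hP aP.
case: (ltngtP (h (al p)) (h p)) => // lt.
  move: h2; rewrite cyl_comm // -?iterD; last lia.
  by rewrite (negPf (min1 _ _ lt)).
move: h1; have [m hm] := iter_back s (iter (h p) t p) (l p).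
rewrite -hm -cyl_comm // -iterD => h1.
by rewrite (negPf (min2 _ _ lt)) in h1.
Qed.

Lemma cyl_glue p : p \in P ->
  exists2 q, q \in P & exists m, iter (h p) t p = iter m s (t^-1%g q).
Proof.
move=> pP; have [[m hm] _] := hP pP; eexists; first exact: hm.
have [m' e] := iter_back s (iter (h p) t p) m.
by exists m'; rewrite permK e.
Qed.

(** If two addresses lie in different rows, descending from both until one row
    is a bottom row finds a cone point on a line between two rows of the other
    cylinder. *)
Lemma cyl_inj p p' x x' y y' : p \in P -> p' \in P ->
  (x < l p)%N -> (x' < l p')%N -> (y <= h p)%N -> (y' <= h p')%N ->
  iter y t (iter x s p) = iter y' t (iter x' s p') -> [/\ p = p', x = x' & y = y'].
Proof.
wlog le : p p' x x' y y' / (y <= y')%N => [wl|] pP pP' xl xl' yh yh' e.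
  case: (leqP y y') => [le|/ltnW le]; first exact: wl.
  by have [] := wl p' p x' x y' y le pP' pP xl' xl yh' yh (esym e).
have {e}e : iter x s p = iter (y' - y) t (iter x' s p').
  apply: (@iter_perm_inj _ t y); rewrite e -iterD; congr iter; lia.
case: (posnP (y' - y)) => [d0|d0].
  move: e; rewrite d0 => e.
  by have [-> ->] := saddle_next_uniq pP pP' xl xl' e; split=> //; lia.
have [_ minh] := hP pP'.
move: e; rewrite cyl_comm //; last lia.
move=> /iter_cross [m e]; have /negP[] := minh (y' - y).-1 m ltac:(lia).
by rewrite -cyl_comm // -?iterS ?prednK // ?cyl_comm -?e //; lia.
Qed.

Lemma realizes_intro (D : diagram) (p : nat -> T) r :
  (forall i, (i < r)%N ->
     [/\ (next_right D i < r)%N, (next_top D i < r)%N & (target D i < r)%N]) ->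
  (forall i, (i < r)%N -> p i \in P) ->
  (forall i j, (i < r)%N -> (j < r)%N -> p i = p j -> i = j) ->
  (forall i, (i < r)%N -> len D i = l (p i) /\ height D i = h (p i)) ->
  (forall i, (i < r)%N -> al (p i) = p (next_right D i)) ->
  (forall i, (i < r)%N -> turn (p (next_right D i)) = p (next_top D i)) ->
  (forall i, (i < r)%N ->
    iter (h (p i)) t (p i) = iter (offset D i) s (t^-1%g (p (target D i)))) ->
  wf_diagram r D /\ realizes r D s t p.
Proof.
move=> lt pP pinj lhE alE topE glueE; split.
  move=> i ir; have [h1 h2 h3] := lt i ir.
  have [e1 e2] := lhE i ir; have [e3 e4] := lhE _ h1.
  have [l0 _ _] := lP (pP i ir).
  by split; rewrite // ?e1 // e2 e4 -alE // cyl_height_next // pP.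
split=> [i ir|i m ir|i ir|i y m ir|i ir|i j x y x' y' ir jr].
- by have [-> _] := lhE i ir; exact: alE.
- by have [-> _] := lhE i ir; apply: below_saddle; exact: pP.
- by have [-> _] := lhE i ir; rewrite end_saddle ?pP // alE // topE.
- by have [_ ->] := lhE i ir; apply: cyl_comm; exact: pP.
- by have [_ ->] := lhE i ir; exact: glueE.
have [-> ->] := lhE i ir; have [-> ->] := lhE j jr => a b c d e.
have [/pinj-> // -> ->] := cyl_inj (pP i ir) (pP j jr) a b c d e.
Qed.

Lemma nextP p : p \in P -> al p \in P.
Proof. by move=> /lP[]. Qed.

Lemma next_inj p p' : p \in P -> p' \in P -> al p = al p' -> p = p'.
Proof.
move=> pP pP' e; have [l0 _ _] := lP pP; have [l0' _ _] := lP pP'.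
apply: (proj1 (@saddle_next_uniq p p' (l p).-1 (l p').-1 _ _ _ _ _)) => //; try lia.
by apply: (@perm_inj _ s); rewrite -!iterS !prednK.
Qed.

Lemma unit_len p : p \in P -> s p \in P -> l p = 1%N.
Proof.
move=> pP spP; have [l0 _ minl] := lP pP.
by case: (ltngtP (l p) 1) => //; [lia | move=> lt; have /negP[] := minl 1 lt].
Qed.

Hypothesis P3 : #|P| = 3.

(** A permutation of three points without fixed point is a 3-cycle. *)
Lemma turn_cycle p : p \in P -> [/\ P = [set p; turn p; turn (turn p)],
  turn (turn (turn p)) = p, turn p != p & turn (turn p) != p].
Proof.
move=> pP; have nf x : x \in P -> turn x != x by rewrite inE.
have qP : turn p \in P by rewrite sing_turn.
have c2 : #|[set p; turn p]| = 2 by rewrite cards2 eq_sym nf.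
have [r rP] : exists r, r \in P :\: [set p; turn p].
  apply/card_gt0P; rewrite cardsD (finset.setIidPr _) ?P3 ?c2 //.
  by apply/fintype.subsetP => x /set2P[] ->.
move: rP; rewrite !inE negb_or => /andP[/andP[rp rq] rr].
have rP : r \in P by rewrite inE.
have PE : P = [set p; turn p; r].
  apply/esym/eqP; rewrite eqEcard P3; apply/andP; split.
    by apply/fintype.subsetP => x /finset.setUP[/set2P[] ->|/set1P ->].
  by rewrite finset.setUC cardsU1 c2 !inE negb_or rp rq.
have : turn r \in P by rewrite sing_turn.
rewrite PE => /finset.setUP[/set2P[e|/perm_inj e]|/set1P e].
- have : turn (turn p) \in P by rewrite !sing_turn.
  rewrite PE => /finset.setUP[/set2P[e'|e']|/set1P e'].
  + by move: rq; rewrite (@perm_inj _ turn _ _ (etrans e (esym e'))) eqxx.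
  + by move: (nf _ qP); rewrite e' eqxx.
  + by rewrite e' e; split=> //; exact: nf.
- by rewrite e eqxx in rp.
- by move: (nf _ rP); rewrite e eqxx.
Qed.

(** Up to the choice of the base point, a permutation of three points is the
    given 3-cycle, its inverse, the identity or a transposition of the base
    point with its image. *)
Lemma pick_base : exists p, p \in P /\ let q := turn p in let r := turn q in
 [\/ [/\ al p = q, al q = r & al r = p],
     [/\ al p = q, al q = p & al r = r],
     [/\ al p = p, al q = q & al r = r] |
     [/\ al p = r, al q = p & al r = q]].
Proof.
have [p pP] : exists p, p \in P by apply/card_gt0P; rewrite P3.
have [PE e3 n1 n2] := turn_cycle pP.
have qP : turn p \in P by rewrite sing_turn.
have rP : turn (turn p) \in P by rewrite sing_turn.
have n3 : turn (turn p) != turn p by rewrite (inj_eq perm_inj).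
have cases x : x \in P -> [\/ x = p, x = turn p | x = turn (turn p)].
  rewrite PE => /finset.setUP[/set2P[e|e]|/set1P e]; by [constructor 1|constructor 2|constructor 3].
have ipq := @next_inj _ _ pP qP; have ipr := @next_inj _ _ pP rP.
have iqr := @next_inj _ _ qP rP.
have [ap aq ar] := And3 (cases _ (nextP pP)) (cases _ (nextP qP)) (cases _ (nextP rP)).
have A0 := fun e => negP n1 (introT eqP (esym (ipq e))).
have A1 := fun e => negP n2 (introT eqP (esym (ipr e))).
have A2 := fun e => negP n3 (introT eqP (esym (iqr e))).
case: ap => [e0|e0|e0]; case: aq => [e1|e1|e1]; case: ar => [e2|e2|e2];
  try (by case: A0; rewrite e0 e1); try (by case: A1; rewrite e0 e2);
  try (by case: A2; rewrite e1 e2).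
- by exists p; split=> //; constructor 3.
- by exists (turn p); split=> //=; rewrite e3; constructor 2.
- by exists p; split=> //; constructor 2.
- by exists p; split=> //; constructor 1.
- by exists p; split=> //; constructor 4.
- by exists (turn (turn p)); split=> //=; rewrite e3; constructor 2.
Qed.

(** Three bottoms of one saddle each face a top made of all three saddles: that
    top would be as short as one of them. *)
Lemma no_horizontal_turn p : p \in P ->
  let q := turn p in let r := turn q in
  al p = p -> al q = q -> al r = r -> False.
Proof.
move=> pP q r ap aq ar; have [PE e3 n1 n2] := turn_cycle pP.
have qP : q \in P by rewrite sing_turn.
have rP : r \in P by rewrite sing_turn.
have tq : iter (l q) s (t^-1%g q) = t^-1%g r by rewrite end_saddle // aq.
have tp : iter (l p) s (t^-1%g p) = t^-1%g q by rewrite end_saddle // ap.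
have tr : iter (l r) s (t^-1%g r) = t^-1%g p by rewrite end_saddle // ar e3.
have row z : z \in P -> exists m, t^-1%g z = iter m s (t^-1%g p).
  rewrite PE => /finset.setUP[/set2P[->|->]|/set1P ->].
  - by exists 0.
  - by exists (l p).
  - by exists (l q + l p); rewrite iterD tp tq.
have [z /row[m1 e1] [m e]] := cyl_glue pP.
move: e; rewrite e1 -iterD => e.
have := cyl_width (l p) pP e; rewrite ap eqxx tp (inj_eq perm_inj).
by rewrite (negPf n1).
Qed.

(** The converse mismatch: one bottom made of all three saddles faces three tops
    of one saddle each. *)
Lemma no_inverse_turn p : p \in P ->
  let q := turn p in let r := turn q in
  al p = r -> al q = p -> al r = q -> False.
Proof.
move=> pP q r ap aq ar; have [PE e3 n1 n2] := turn_cycle pP.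
have qP : q \in P by rewrite sing_turn.
have rP : r \in P by rewrite sing_turn.
have n3 : r != q by rewrite (inj_eq perm_inj).
have [z zP [m e]] := cyl_glue pP.
have az : turn (al z) = z.
  by move: zP; rewrite PE => /finset.setUP[/set2P[->|->]|/set1P ->];
    rewrite ?ap ?aq ?ar.
have := cyl_width (l z) pP e; rewrite end_saddle // az eqxx => /esym wp.
have wr : iter (l z) s r == r by rewrite -ap iter_fix_row.
have wq : iter (l z) s q == q by rewrite -ar iter_fix_row.
move: zP (zP) => zP; rewrite PE => /finset.setUP[/set2P[zE|zE]|/set1P zE].
- by move: wp; rewrite zE ap (negPf n2).
- by move: wq; rewrite zE aq eq_sym (negPf n1).
- by move: wr; rewrite zE ar eq_sym (negPf n3).
Qed.


Lemma one_cyl_case p : p \in P ->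
  let q := turn p in let r := turn q in
  al p = q -> al q = r -> al r = p ->
  exists k, [/\ (k < l p + l q + l r)%N,
    wf_diagram 3 (one_cyl (l p) (l q) (l r) (h p) k) &
    realizes 3 (one_cyl (l p) (l q) (l r) (h p) k) s t (nth p [:: p; q; r])].
Proof.
move=> pP q r ap aq ar; have [PE e3 n1 n2] := turn_cycle pP.
have qP : q \in P by rewrite sing_turn.
have rP : r \in P by rewrite sing_turn.
have n3 : r != q by rewrite (inj_eq perm_inj).
have tq : iter (l q) s (t^-1%g q) = t^-1%g p by rewrite end_saddle // aq e3.
have tp : iter (l p) s (t^-1%g p) = t^-1%g r by rewrite end_saddle // ap.
have tr : iter (l r) s (t^-1%g r) = t^-1%g q by rewrite end_saddle // ar.
have row z : z \in P -> exists m, t^-1%g z = iter m s (t^-1%g p).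
  rewrite PE => /finset.setUP[/set2P[->|->]|/set1P ->].
  - by exists 0.
  - by exists (l r + l p); rewrite iterD tp tr.
  - by exists (l p).
have [z /row[m1 e1] [m e]] := cyl_glue pP.
move: e; rewrite e1 -iterD; set k := (m + m1)%N => e.
set W := (l p + l q + l r)%N.
have W0 : (0 < W)%N by have [] := lP pP; rewrite /W; lia.
have Wp : iter W s (t^-1%g p) = t^-1%g p.
  have -> : W = (l q + (l r + l p))%N by rewrite /W; lia.
  by rewrite !iterD tp tr tq.
have hq : h q = h p by rewrite -ap cyl_height_next.
have hr : h r = h p by rewrite -hq -aq cyl_height_next.
(* The row of p has period W, so the twist matters modulo W only. *)
have {}e : iter (h p) t p = iter (k %% W) s (t^-1%g p) by rewrite e iter_modn.
exists (k %% W); rewrite ltn_mod W0.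
suff [] : wf_diagram 3 (one_cyl (l p) (l q) (l r) (h p) (k %% W)) /\
  realizes 3 (one_cyl (l p) (l q) (l r) (h p) (k %% W)) s t (nth p [:: p; q; r]) by [].
apply: realizes_intro; first by case=> [|[|[|]]].
- by case=> [|[|[|]]].
- case=> [|[|[|i]]] [|[|[|j]]] //= _ _ /eqP; rewrite ?(negPf n1) ?(negPf n2) ?(negPf n3) //;
  by rewrite eq_sym ?(negPf n1) ?(negPf n2) ?(negPf n3).
- by case=> [|[|[|]]].
- by case=> [|[|[|]]].
- by case=> [|[|[|]]].
case=> [|[|[|]]] //= _.
- by rewrite hq -{1}ap cyl_comm // e addnC iterD.
- have rE : r = iter (l q + l p) s p by rewrite iterD ap aq.
  by rewrite hr {1}rE cyl_comm // e -iterD; congr iter; lia.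
Qed.

(** The bottom r alone can only face the top q alone, since the other top is
    made of two saddles, one of which is r itself; hence [l q = l r]. *)
Lemma two_cyl_case p : p \in P ->
  let q := turn p in let r := turn q in
  al p = q -> al q = p -> al r = r ->
  exists k0 k2, [/\ (k0 < l p + l r)%N, (k2 < l r)%N, l q = l r,
    wf_diagram 3 (two_cyl (l p) (l r) (h p) (h r) k0 k2) &
    realizes 3 (two_cyl (l p) (l r) (h p) (h r) k0 k2) s t (nth p [:: p; q; r])].
Proof.
move=> pP q r ap aq ar; have [PE e3 n1 n2] := turn_cycle pP.
have qP : q \in P by rewrite sing_turn.
have rP : r \in P by rewrite sing_turn.
have n3 : r != q by rewrite (inj_eq perm_inj).
have tp : iter (l p) s (t^-1%g p) = t^-1%g r by rewrite end_saddle // ap.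
have tq : iter (l q) s (t^-1%g q) = t^-1%g q by rewrite end_saddle // aq.
have tr : iter (l r) s (t^-1%g r) = t^-1%g p by rewrite end_saddle // ar e3.
have [m2 e2] : exists m, iter (h r) t r = iter m s (t^-1%g q).
  have [z + [m e]] := cyl_glue rP.
  have := cyl_width (l r) rP e; rewrite ar eqxx => wz.
  rewrite PE => /finset.setUP[/set2P[zE|zE]|/set1P zE]; last 2 first.
  - by exists m; rewrite e zE.
  - by move: wz; rewrite zE tr (inj_eq perm_inj) eq_sym (negPf n2).
  move: wz; rewrite zE -(iter_fix_row _ _ (l p)) tp tr.
  by rewrite (inj_eq perm_inj) eq_sym (negPf n2).
(* The row of r and the line below q have the same periods; compare first returns. *)
have lqr : l q = l r.
  have [lq0 _ minq] := lP qP; have [lr0 _ minr] := lP rP.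
  have wr : iter (l q) s r == r by rewrite -(cyl_width _ rP e2) tq.
  have wq : iter (l r) s (t^-1%g q) = t^-1%g q.
    by apply/eqP; rewrite (cyl_width _ rP e2) ar.
  case: (ltngtP (l q) (l r)) => // lt.
    have /negP[] := minr (l q) ltac:(lia).
    by rewrite (eqP wr).
  have /negP[] := minq (l r) ltac:(lia).
  by rewrite -(below_saddle qP lt) wq permKV.
(* A top made of q alone would give p and q the same image under a row shift. *)
have [m0 e0] : exists m, iter (h p) t p = iter m s (t^-1%g p).
  have [z + [m e]] := cyl_glue pP.
  rewrite PE => /finset.setUP[/set2P[zE|zE]|/set1P zE].
  - by exists m; rewrite e zE.
  - have := cyl_width (l q) pP e; rewrite zE tq eqxx => /esym/eqP wp.
    by move: n1; rewrite -/q -(inj_eq (@iter_perm_inj _ s (l q))) aq wp eqxx.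
  - by exists (m + l p)%N; rewrite iterD tp e zE.
have hq : h q = h p by rewrite -ap cyl_height_next.
set W := (l p + l r)%N.
have r0 : (0 < l r)%N by have [] := lP rP.
have W0 : (0 < W)%N by rewrite /W; lia.
have Wp : iter W s (t^-1%g p) = t^-1%g p by rewrite /W addnC iterD tp tr.
have {}e0 : iter (h p) t p = iter (m0 %% W) s (t^-1%g p) by rewrite e0 iter_modn.
have {}e2 : iter (h r) t r = iter (m2 %% l r) s (t^-1%g q).
  by rewrite e2 iter_modn // -lqr.
exists (m0 %% W), (m2 %% l r); rewrite !ltn_mod W0 r0.
suff [] : wf_diagram 3 (two_cyl (l p) (l r) (h p) (h r) (m0 %% W) (m2 %% l r)) /\
  realizes 3 (two_cyl (l p) (l r) (h p) (h r) (m0 %% W) (m2 %% l r)) s t (nth p [:: p; q; r]) by [].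
apply: realizes_intro; first by case=> [|[|[|]]].
- by case=> [|[|[|]]].
- case=> [|[|[|i]]] [|[|[|j]]] //= _ _ /eqP; rewrite ?(negPf n1) ?(negPf n2) ?(negPf n3) //;
  by rewrite eq_sym ?(negPf n1) ?(negPf n2) ?(negPf n3).
- by case=> [|[|[|]]].
- by case=> [|[|[|]]].
- by case=> [|[|[|]]].
case=> [|[|[|]]] //= _.
by rewrite hq -ap cyl_comm // e0 addnC iterD.
Qed.

End Saddles.

Theorem diagram_classification : #|P| = 3 ->
  (exists l0 l1 l2 h k p, let D := one_cyl l0 l1 l2 h k in
    [/\ (k < l0 + l1 + l2)%N, wf_diagram 3 D, realizes 3 D s t p &
        has_unit -> [|| l0 == 1, l1 == 1 | l2 == 1]]) \/
  (exists l0 l2 h0 h2 k0 k2 p, let D := two_cyl l0 l2 h0 h2 k0 k2 in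
    [/\ (k0 < l0 + l2)%N && (k2 < l2)%N, wf_diagram 3 D, realizes 3 D s t p &
        has_unit -> (l0 == 1) || (l2 == 1)]).
Proof.
move=> P3; have [l lP] := saddle_lengths_ex; have [h hP] := cyl_heights_ex.
have [p [pP cases]] := pick_base lP P3; have [PE _ _ _] := turn_cycle P3 pP.
case: cases => [[ap aq ar]|[ap aq ar]|[ap aq ar]|[ap aq ar]].
- have [k [kW wf re]] := one_cyl_case lP hP P3 pP ap aq ar.
  left; do 6 eexists; split; [exact: kW | exact: wf | exact: re |].
  case=> z zP /(unit_len lP zP); move: zP.
  by rewrite PE => /finset.setUP[/set2P[->|->]|/set1P ->] ->; rewrite eqxx ?orbT.
- have [k0 [k2 [k0W k2W lqr wf re]]] := two_cyl_case lP hP P3 pP ap aq ar.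
  right; exists (l p), (l (turn (turn p))), (h p), (h (turn (turn p))), k0, k2.
  eexists; split; [by rewrite k0W k2W | exact: wf | exact: re |].
  case=> z zP /(unit_len lP zP); move: zP.
  rewrite PE => /finset.setUP[/set2P[->|->]|/set1P ->].
  + by move=> ->; rewrite eqxx ?orbT.
  + by rewrite lqr => ->; rewrite eqxx ?orbT.
  + by move=> ->; rewrite eqxx ?orbT.
- by case: (no_horizontal_turn lP hP P3 pP ap aq ar).
- by case: (no_inverse_turn lP hP P3 pP ap aq ar).
Qed.


End Sing.

(** * Upper bounds: counting cylinder parameters *)

(** The integer form of 1 / s^2 <= 1 / (s - 1) - 1 / s: rounding down preserves
    the telescoping bound. *)
Lemma tail_step K a s : (1 < s)%N -> (a * s ^ 2 <= K)%N ->
  (a + K %/ s <= K %/ s.-1)%N.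
Proof.
move=> s1 aK; rewrite leq_divRL; last lia.
have h1 : (a * s <= K %/ s)%N by rewrite leq_divRL -?mulnA ?mulnn //; lia.
have h2 : (K %/ s * s <= K)%N by exact: leq_trunc_div.
nia.
Qed.

Lemma tail_sum K (f : nat -> nat) m j : (0 < m)%N ->
  (forall s, (f s * s ^ 2 <= K)%N) ->
  (\sum_(s <- iota m.+1 j) f s <= K %/ m)%N.
Proof.
move=> m0 fK; suff : (\sum_(s <- iota m.+1 j) f s + K %/ (m + j) <= K %/ m)%N.
  by apply: leq_trans; exact: leq_addr.
elim: j => [|j IH]; first by rewrite big_nil addn0.
rewrite -[j.+1]addn1 iotaD big_cat /= big_cons big_nil.
have := @tail_step K (f (m.+1 + j)%N) (m.+1 + j)%N ltac:(lia) (fK _).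
rewrite addSn /= addn1 addnS addn0 -addnA => h.
by apply: leq_trans IH; rewrite leq_add2l.
Qed.

Lemma full_sum K (f : nat -> nat) n : (forall s, (f s * s ^ 2 <= K)%N) ->
  (\sum_(s <- iota 1 n) f s <= 2 * K)%N.
Proof.
move=> fK; case: n => [|n]; first by rewrite big_nil.
rewrite /= big_cons mul2n -addnn leq_add //; first by rewrite -(muln1 (f 1)) -{2}(exp1n 2).
by have := tail_sum n (ltn0Sn 0) fK; rewrite divn1.
Qed.

(** Only the existence of a code and its injectivity are required, so a surface
    may have several codes. *)
Lemma card_le_codes (X : finType) (C : eqType) (c0 : C) (A : {set X})
    (r : X -> C -> Prop) (L : seq C) :
  (forall x, x \in A -> exists2 c, c \in L & r x c) ->
  (forall x y c, r x c -> r y c -> x = y) ->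
  (#|A| <= size L)%N.
Proof.
move=> ex inj.
have /fin_all_exists [f fP] : forall x, exists c, x \in A -> c \in L /\ r x c.
  move=> x; case xA: (x \in A); last by exists c0.
  by have [c] := ex x xA; exists c.
rewrite cardE -(size_map f); apply: uniq_leq_size.
  rewrite map_inj_in_uniq ?enum_uniq // => x y.
  rewrite !mem_enum => /fP[_ rx] /fP[_ ry] e.
  by apply: (inj _ _ (f x)); rewrite // e.
by move=> c /mapP[x]; rewrite mem_enum => /fP[cL _] ->.
Qed.

Lemma relabelings_id n (o : gluing n) : o \in relabelings o.
Proof.
apply/imsetP; exists 1%g; first by rewrite inE.
by rewrite !conjg1; case: o.
Qed.

Lemma relabelings_conj n (o : gluing n) f :
  relabelings ((o.1 ^ f)%g, (o.2 ^ f)%g) = relabelings o.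
Proof.
apply/setP => o'; apply/imsetP/imsetP => -[g _ ->] /=.
  by exists (f * g)%g; rewrite ?inE // !conjgM.
by exists (f^-1 * g)%g; rewrite ?inE //= -!conjgM !mulKVg.
Qed.

Lemma relabelings_eqP n (o o' : gluing n) :
  (exists f, o' = ((o.1 ^ f)%g, (o.2 ^ f)%g)) <-> relabelings o = relabelings o'.
Proof.
split=> [[f ->]|e]; first by rewrite relabelings_conj.
have := relabelings_id o'; rewrite -e => /imsetP[f _ ->]; by exists f.
Qed.

Lemma num_surfaces_le n (P Q : gluing n -> Prop) :
  (forall o, P o -> Q o) -> (num_surfaces P <= num_surfaces Q)%N.
Proof.
move=> PQ; apply: subset_leq_card; apply: imsetS.
apply/fintype.subsetP => o; by rewrite !inE => /PQ.
Qed.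

Lemma num_surfaces_or n (P Q : gluing n -> Prop) :
  (num_surfaces (fun o => P o \/ Q o) <= num_surfaces P + num_surfaces Q)%N.
Proof.
rewrite /num_surfaces -cardsUI -[leqLHS]addn0 leq_add // subset_leq_card //.
rewrite -imsetU; apply: imsetS; apply/fintype.subsetP => o; rewrite !inE.
by case=> h; apply/orP; [left|right]; apply: asboolT.
Qed.

Definition comb_H2 n (o : gluing n) := connected_gluing o /\ #|sing o.1 o.2| = 3.

(** One-cylinder parameters form a list of length 5, two-cylinder parameters one
    of length 6; the value on other lists is arbitrary. *)
Definition decode (c : seq nat) : diagram :=
  match c with
  | [:: l0; l1; l2; h; k] => one_cyl l0 l1 l2 h k
  | [:: l0; l2; h0; h2; k0; k2] => two_cyl l0 l2 h0 h2 k0 k2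
  | _ => one_cyl 0 0 0 0 0
  end.

Definition has_code n (X : {set gluing n}) (c : seq nat) := exists (o : gluing n) p,
  [/\ X = relabelings o, connected_gluing o, wf_diagram 3 (decode c) &
      realizes 3 (decode c) o.1 o.2 p].

Lemma has_code_inj n (X Y : {set gluing n}) c : has_code X c -> has_code Y c -> X = Y.
Proof.
move=> [ o [p [-> tr wf re]]] [ o' [p' [-> _ _ re']]].
have [f [e1 e2]] := realizes_conj wf isT tr re re'.
by apply/relabelings_eqP; exists f; rewrite -e1 -e2; case: (o').
Qed.

Lemma num_surfaces_codes n (P : gluing n -> Prop) (L : seq (seq nat)) :
  (forall o, P o -> exists2 c, c \in L & has_code (relabelings o) c) ->
  (num_surfaces P <= size L)%N.
Proof.
move=> ex; apply: (card_le_codes [::] (r := @has_code n)); last exact: has_code_inj.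
by move=> X /imsetP[ o]; rewrite !inE => /ex[c cL h] ->; exists c.
Qed.

Definition box2 A B := [seq (a, b) | a <- iota 0 A, b <- iota 0 B].
Definition box3 A B C := [seq (u, c) | u <- box2 A B, c <- iota 0 C].

Lemma size_box2 A B : size (box2 A B) = (A * B)%N.
Proof. by rewrite size_allpairs !size_iota. Qed.

Lemma size_box3 A B C : size (box3 A B C) = (A * B * C)%N.
Proof. by rewrite size_allpairs size_box2 size_iota. Qed.

Lemma mem_box2 A B a b : (a < A)%N -> (b < B)%N -> (a, b) \in box2 A B.
Proof. by move=> aA bB; apply: allpairs_f; rewrite mem_iota. Qed.

Lemma mem_box3 A B C a b c : (a < A)%N -> (b < B)%N -> (c < C)%N ->
  (a, b, c) \in box3 A B C.
Proof. by move=> aA bB cC; apply: allpairs_f; rewrite ?mem_box2 ?mem_iota. Qed.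

(** The number H of rows determines the circumference [n %/ H], and the third
    length is what remains. *)
Definition one_cyl_codes n :=
  [seq [:: u.1.1; u.1.2; n %/ H - u.1.1 - u.1.2; H.-1; u.2]%N |
     H <- iota 1 n, u <- box3 (n %/ H) (n %/ H) (n %/ H)].

(** If H rows belong to the large cylinder and s rows exist in total, then
    l0 * H + l2 * s = n.  It is better to enumerate l2, at most n / s, and to
    deduce l0 than the other way round: as s > H, the sum over s of (n / s)^2
    then contributes a factor 1 / H. *)
Definition two_cyl_codes n :=
  [seq [:: (n - u.1.1.+1 * v.2) %/ v.1 ; u.1.1.+1; v.1.-1;
           (v.2 - v.1).-1; u.2; u.1.2]%N |
     v <- [seq (H, s) | H <- iota 1 n, s <- iota H.+1 n],
     u <- box3 (n %/ v.2) (n %/ v.2) (n %/ v.1)].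

(** With one length equal to 1, one enumeration fewer remains. *)
Definition one_cyl_unit_codes n :=
  [seq [:: 1; u.1; n %/ H - 1 - u.1; H.-1; u.2]%N |
     H <- iota 1 n, u <- box2 (n %/ H) (n %/ H)] ++
  [seq [:: u.1; 1; n %/ H - u.1 - 1; H.-1; u.2]%N |
     H <- iota 1 n, u <- box2 (n %/ H) (n %/ H)] ++
  [seq [:: u.1; n %/ H - u.1 - 1; 1; H.-1; u.2]%N |
     H <- iota 1 n, u <- box2 (n %/ H) (n %/ H)].

(** If l2 = 1, the small cylinder is determined by the large one and its twist is
    0.  If l0 = 1, then n = l2 * s + H with H < s, so that l2 and H are the
    quotient and the remainder of n by s. *)
Definition two_cyl_unit_codes n :=
  [seq [:: u.1; 1; H.-1; (n - u.1.+1 * H).-1; u.2; 0]%N |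
     H <- iota 1 n, u <- box2 (n %/ H) (n %/ H)] ++
  [seq [:: 1; n %/ s; (n %% s).-1; (s - n %% s).-1; u.1; u.2]%N |
     s <- iota 1 n, u <- box2 (n %/ s).+1 (n %/ s)].

Lemma size_codes (S T R : Type) (f : S -> T -> R) (s : seq S) (t : S -> seq T) :
  size [seq f x y | x <- s, y <- t x] = (\sum_(x <- s) size (t x))%N.
Proof. by rewrite size_allpairs_dep sumnE big_map. Qed.

Lemma size_one_cyl_codes n : (size (one_cyl_codes n) <= 2 * n ^ 3)%N.
Proof.
rewrite size_codes; under eq_bigr do rewrite size_box3.
apply: full_sum => H; have h := leq_trunc_div n H; have h' := leq_div n H.
have -> : (n %/ H * (n %/ H) * (n %/ H) * H ^ 2 =
           n %/ H * H * (n %/ H * H) * (n %/ H))%N by ring.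
have -> : (n ^ 3 = n * n * n)%N by ring.
by rewrite !leq_mul.
Qed.

Lemma square_sum n : (\sum_(H <- iota 1 n) n %/ H * (n %/ H) <= 2 * n ^ 2)%N.
Proof.
apply: full_sum => H; have h := leq_trunc_div n H.
have -> : (n %/ H * (n %/ H) * H ^ 2 = n %/ H * H * (n %/ H * H))%N by ring.
by rewrite !expnS expn0 muln1 !leq_mul.
Qed.

Lemma size_one_cyl_unit_codes n : (size (one_cyl_unit_codes n) <= 6 * n ^ 2)%N.
Proof.
rewrite !size_cat !size_codes.
under eq_bigr do rewrite size_box2.
have := square_sum n; lia.
Qed.

(** The inner sum over s > H of (n / s)^2 is at most n^2 / H. *)
Lemma size_two_cyl_codes n : (size (two_cyl_codes n) <= 2 * n ^ 3)%N.
Proof.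
rewrite size_codes; under eq_bigr do rewrite size_box3.
rewrite big_allpairs_dep /=.
under eq_bigr do rewrite -big_distrl /=.
have le : (\sum_(H <- iota 1 n) (\sum_(s <- iota H.+1 n) n %/ s * (n %/ s)) * (n %/ H)
  <= \sum_(H <- iota 1 n) n ^ 2 %/ H * (n %/ H))%N.
  rewrite big_seq [leqRHS]big_seq; apply: leq_sum => H; rewrite mem_iota => /andP[H0 _].
  rewrite leq_mul2r; apply/orP; right; apply: tail_sum => // s.
  have h := leq_trunc_div n s.
  have -> : (n %/ s * (n %/ s) * s ^ 2 = n %/ s * s * (n %/ s * s))%N by ring.
  by rewrite !expnS expn0 muln1 !leq_mul.
apply: leq_trans le _; apply: full_sum => H.
have -> : (n ^ 2 %/ H * (n %/ H) * H ^ 2 = n %/ H * H * (n ^ 2 %/ H * H))%N by ring.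
by rewrite expnS leq_mul // leq_trunc_div.
Qed.

Lemma size_two_cyl_unit_codes n : (size (two_cyl_unit_codes n) <= 6 * n ^ 2)%N.
Proof.
rewrite size_cat !size_codes.
under eq_bigr do rewrite size_box2.
under [X in (_ + X)%N]eq_bigr do rewrite size_box2.
have : (\sum_(s <- iota 1 n) (n %/ s).+1 * (n %/ s)
   <= \sum_(s <- iota 1 n) 2 * (n %/ s * (n %/ s)))%N.
  by apply: leq_sum => s _; nia.
rewrite -big_distrr /=; have := square_sum n; lia.
Qed.

Lemma mem_one_cyl_codes n l0 l1 l2 h k : ((l0 + l1 + l2) * h.+1 = n)%N ->
  (0 < l0)%N -> (0 < l1)%N -> (0 < l2)%N -> (k < l0 + l1 + l2)%N ->
  [:: l0; l1; l2; h; k] \in one_cyl_codes n /\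
  ([|| l0 == 1, l1 == 1 | l2 == 1] -> [:: l0; l1; l2; h; k] \in one_cyl_unit_codes n).
Proof.
move=> en p0 p1 p2 kW.
have eW : n %/ h.+1 = (l0 + l1 + l2)%N by rewrite -en mulnK.
have hn : h.+1 \in iota 1 n by rewrite mem_iota -en; nia.
split.
  apply/allpairsPdep; exists h.+1, (l0, l1, k); rewrite eW; split=> //.
    apply: mem_box3; lia.
  by congr [:: _; _; _; _; _]; rewrite /=; lia.
rewrite !mem_cat => /or3P[] /eqP e; apply/or3P;
  [constructor 1; apply/allpairsPdep; exists h.+1, (l1, k) |
   constructor 2; apply/allpairsPdep; exists h.+1, (l0, k) |
   constructor 3; apply/allpairsPdep; exists h.+1, (l0, k)];
  rewrite eW; split=> //; try (by apply: mem_box2; lia);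
  by congr [:: _; _; _; _; _]; rewrite /=; lia.
Qed.

Lemma mem_two_cyl_codes n l0 l2 h0 h2 k0 k2 :
  ((l0 + l2) * h0.+1 + l2 * h2.+1 = n)%N ->
  (0 < l0)%N -> (0 < l2)%N -> (k0 < l0 + l2)%N -> (k2 < l2)%N ->
  [:: l0; l2; h0; h2; k0; k2] \in two_cyl_codes n /\
  ((l0 == 1) || (l2 == 1) -> [:: l0; l2; h0; h2; k0; k2] \in two_cyl_unit_codes n).
Proof.
move=> en p0 p2 k0W k2W.
have hn : h0.+1 \in iota 1 n by rewrite mem_iota; nia.
have w2 : (l0 + l2 <= n %/ h0.+1)%N by rewrite leq_divRL //; lia.
split.
  have w1 : (l2 <= n %/ (h0.+1 + h2.+1))%N by rewrite leq_divRL //; nia.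
  apply/allpairsPdep; exists (h0.+1, h0.+1 + h2.+1)%N, (l2.-1, k2, k0); split.
  - by apply: allpairs_f_dep; rewrite // mem_iota; nia.
  - by apply: mem_box3; rewrite /=; lia.
  rewrite /= (prednK p2).
  have -> : (n - l2 * (h0.+1 + h2.+1) = l0 * h0.+1)%N by rewrite -en; nia.
  by rewrite mulnK //; congr [:: _; _; _; _; _; _]; lia.
rewrite mem_cat => /orP[] /eqP e; apply/orP; [right|left].
  set s := (h0.+1 + h2.+1)%N.
  have es : n = (l2 * s + h0.+1)%N by rewrite -en e /s; lia.
  have lt : (h0.+1 < s)%N by rewrite /s; lia.
  have e1 : n %/ s = l2 by rewrite es divnMDl ?divn_small ?addn0 //; lia.
  have e2 : n %% s = h0.+1 by rewrite es modnMDl modn_small.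
  apply/allpairsPdep; exists s, (k0, k2); rewrite e1 e2; split=> //.
  - by rewrite mem_iota es; nia.
  - by apply: mem_box2; lia.
  by rewrite /= e /s; congr [:: _; _; _; _; _; _]; lia.
apply/allpairsPdep; exists h0.+1, (l0, k0); split=> //.
  by apply: mem_box2; lia.
have -> : (n - (l0, k0).1.+1 * h0.+1 = h2.+1)%N by rewrite /= -en e; nia.
by rewrite /=; congr [:: _; _; _; _; _; _]; lia.
Qed.

(** Each surface in H(2) has a code in the general list, which lies in the short
    list as soon as there is a horizontal unit saddle. *)
Lemma comb_codes n (o : gluing n) : comb_H2 o ->
  exists2 c, c \in one_cyl_codes n ++ two_cyl_codes n /\
     (has_unit o.1 o.2 -> c \in one_cyl_unit_codes n ++ two_cyl_unit_codes n) &
     has_code (relabelings o) c.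
Proof.
move=> [tr P3].
case: (diagram_classification P3) => [[l0 [l1 [l2 [h [k [p [kW wf re un]]]]]]]|].
  have := realizes_card wf isT tr re.
  rewrite card_ord !big_nat_recr //= big_geq // add0n => en.
  have [_ _ _ p0 _] := wf 0 isT; have [_ _ _ p1 _] := wf 1 isT.
  have [_ _ _ p2 _] := wf 2 isT.
  have [||||| m1 m2] // := @mem_one_cyl_codes n l0 l1 l2 h k; first by rewrite en; lia.
  exists [:: l0; l1; l2; h; k]; last by exists o, p.
  by split=> [|/un /m2 m]; rewrite mem_cat ?m1 ?m.
move=> [l0 [l2 [h0 [h2 [k0 [k2 [p [/andP[k0W k2W] wf re un]]]]]]]].
have := realizes_card wf isT tr re.
rewrite card_ord !big_nat_recr //= big_geq // add0n => en.
have [_ _ _ p0 _] := wf 0 isT; have [_ _ _ p2 _] := wf 2 isT.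
have [||||| m1 m2] // := @mem_two_cyl_codes n l0 l2 h0 h2 k0 k2; first by rewrite en; lia.
exists [:: l0; l2; h0; h2; k0; k2]; last by exists o, p.
by split=> [|/un /m2 m]; rewrite mem_cat ?m1 ?m orbT.
Qed.

Theorem upper_cubic n : (num_surfaces (@comb_H2 n) <= 4 * n ^ 3)%N.
Proof.
apply: leq_trans (num_surfaces_codes _ (L := one_cyl_codes n ++ two_cyl_codes n)) _.
  by move=> o /comb_codes[c [cL _] hc]; exists c.
rewrite size_cat; have := size_one_cyl_codes n; have := size_two_cyl_codes n; lia.
Qed.

Lemma upper_quadratic_horizontal n :
  (num_surfaces (fun o : gluing n => comb_H2 o /\ has_unit o.1 o.2) <= 12 * n ^ 2)%N.
Proof.
apply: leq_trans (num_surfaces_codes _ (L := one_cyl_unit_codes n ++ two_cyl_unit_codes n)) _.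
  by move=> o [/comb_codes[c [_ cL] hc] /cL]; exists c.
rewrite size_cat; have := size_one_cyl_unit_codes n; have := size_two_cyl_unit_codes n; lia.
Qed.

Lemma sing_swap (T : finType) (s t : {perm T}) : sing t s = sing s t.
Proof.
apply/setP => x; rewrite !inE -invg_comm.
by rewrite -(inj_eq (@perm_inj _ [~ s, t]%g)) permKV eq_sym.
Qed.

Definition swap n (o : gluing n) : gluing n := (o.2, o.1).

Lemma comb_H2_swap n (o : gluing n) : comb_H2 (swap o) <-> comb_H2 o.
Proof.
rewrite /comb_H2 /connected_gluing /swap /= sing_swap.
by rewrite [[set o.2; o.1]]finset.setUC.
Qed.

(** Exchanging the two directions is an injection on surfaces. *)
Lemma num_surfaces_swap n (P : gluing n -> Prop) :
  (num_surfaces (fun o => P (swap o)) <= num_surfaces P)%N.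
Proof.
pose F (X : {set gluing n}) := [set swap o | o in X].
have Finj : injective F by apply: imset_inj => -[a b] [c d] [-> ->].
rewrite /num_surfaces -(card_imset _ Finj); apply: subset_leq_card.
apply/fintype.subsetP => _ /imsetP[_ /imsetP[ o Po ->] ->].
apply/imsetP; exists (swap o).
  by move: Po; rewrite !inE.
apply/setP => o'; apply/imsetP/imsetP.
  by case=> _ /imsetP[f _ ->] ->; exists f.
by case=> f _ ->; exists ((o.1 ^ f)%g, (o.2 ^ f)%g) => //; apply/imsetP; exists f.
Qed.

Theorem upper_quadratic n : (num_surfaces (fun o : gluing n =>
  comb_H2 o /\ (has_unit o.1 o.2 \/ has_unit o.2 o.1)) <= 24 * n ^ 2)%N.
Proof.
pose Q (o : gluing n) := comb_H2 o /\ has_unit o.1 o.2.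
apply: (@leq_trans (num_surfaces (fun o => Q o \/ Q (swap o)))).
  apply: num_surfaces_le => o [h [u|u]]; [left|right]; split=> //.
  exact/comb_H2_swap.
apply: leq_trans (num_surfaces_or _ _) _.
have := num_surfaces_swap Q; have := upper_quadratic_horizontal n.
rewrite -/Q; lia.
Qed.

(** * Lower bounds: gluings whose rows form a single long cycle *)

Lemma card_fibers (A B : finType) (f : A -> B) (S : {set A}) k :
  (forall b, (#|[set a in S | f a == b]| <= k)%N) ->
  (#|S| <= k * #|[set f a | a in S]|)%N.
Proof.
move=> fib; rewrite -sum1_card (partition_big_imset f) /= mulnC -sum_nat_const.
apply: leq_sum => b _; rewrite sum1dep_card; apply: leq_trans (fib b).
by apply: eq_leq; apply: eq_card => a; rewrite !inE.
Qed.

Definition long_cycle (T : finType) (c : {perm T}) := #|porbits c| == 1.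

Section LongCycle.
Variables (T : finType) (c : {perm T}).
Hypothesis cc : long_cycle c.

Lemma long_cycle_porbit x : porbit c x = finset.setT.
Proof.
have /cards1P[X PX] := cc.
have eX y : porbit c y = X.
  by apply/set1P; rewrite -PX; apply: imset_f.
apply/setP => y; rewrite inE.
by rewrite (eX x) -(eX y) porbit_id.
Qed.

Lemma long_cycle_iter x y : exists2 i, (i < #|T|)%N & y = iter i c x.
Proof.
have : y \in porbit c x by rewrite long_cycle_porbit inE.
rewrite porbit_traject long_cycle_porbit cardsT => /trajectP[i lt ->].
by exists i.
Qed.

Lemma long_cycle_inj x i j : (i < #|T|)%N -> (j < #|T|)%N ->
  iter i c x = iter j c x -> i = j.
Proof.
move=> il jl e; have := uniq_traject_porbit c x.
rewrite long_cycle_porbit cardsT => /(nth_uniq x) u.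
apply/eqP; rewrite -(u i j) ?size_traject // !nth_traject // e; exact: eqxx.
Qed.

Lemma long_cycle_period x : iter #|T| c x = x.
Proof. by have := iter_porbit c x; rewrite long_cycle_porbit cardsT. Qed.

Lemma long_cycle_trans (t : {perm T}) (x0 : T) :
  [transitive <<[set c; t]>>%g, on [set: T] | 'P]%act.
Proof.
apply/imsetP; exists x0; first by rewrite inE.
apply/esym/setP => y; rewrite inE.
have [i _ ->] := long_cycle_iter x0 y; rewrite -permX.
by apply: mem_orbit; apply: groupX; apply: mem_gen; rewrite !inE eqxx.
Qed.

End LongCycle.

(** Two long cycles are conjugate, with a prescribed image of one point. *)
Lemma long_cycle_conj (T : finType) (c d : {perm T}) x0 w :
  long_cycle c -> long_cycle d ->
  exists f : {perm T}, f x0 = w /\ (c ^ f)%g = d.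
Proof.
move=> cc cd.
have /fin_all_exists [f fP] : forall a, exists b, exists2 i, (i < #|T|)%N &
    a = iter i c x0 /\ b = iter i d w.
  by move=> a; have [i il e] := long_cycle_iter cc x0 a; exists (iter i d w), i.
have fE i : (i < #|T|)%N -> f (iter i c x0) = iter i d w.
  move=> il; have [j jl [e ->]] := fP (iter i c x0).
  by rewrite (long_cycle_inj cc il jl e).
have finj : injective f.
  move=> a b; have [i il [-> ->]] := fP a; have [j jl [-> ->]] := fP b.
  by move=> /(long_cycle_inj cd il jl) ->.
have T0 : (0 < #|T|)%N by apply/card_gt0P; exists x0.
exists (perm finj); split; first by rewrite permE -[x0]/(iter 0 c x0) fE.
apply/permP => b; rewrite -(permKV (perm finj) b) permJ.
set a := ((perm finj)^-1)%g b; have [i il e] := long_cycle_iter cc x0 a.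
rewrite !permE e fE // -!iterS.
case: (ltnP i.+1 #|T|) => [lt|ge]; first by rewrite fE.
have -> : i.+1 = #|T| by lia.
by rewrite !long_cycle_period // -[x0]/(iter 0 c x0) fE.
Qed.

(** An element of the centralizer of a long cycle is determined by the image of
    one point. *)
Lemma centralizer_eq (T : finType) (c f g : {perm T}) x0 : long_cycle c ->
  (c ^ f)%g = c -> (c ^ g)%g = c -> f x0 = g x0 -> f = g.
Proof.
move=> cc cf cg e; apply/permP => x; have [i _ ->] := long_cycle_iter cc x0 x.
have com h : (c ^ h)%g = c -> h (iter i c x0) = iter i c (h x0).
  by move=> ch; elim: i => //= i <-; rewrite -permJ ch.
by rewrite !com // e.
Qed.

Section Lower.
Variable n : nat.
Variable c : {perm 'I_n}.
Hypothesis cc : long_cycle c.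
Variable x0 : 'I_n.

Local Notation split2 x y := (tperm x y * c)%g.

Lemma split2_porbits x y : x != y -> #|porbits (split2 x y)| = 2.
Proof.
move=> xy; have := porbits_mul_tperm c x y.
by rewrite /= (long_cycle_porbit cc) inE addn0 (eqP cc) xy.
Qed.

Lemma split2_notin x y : x != y -> x \notin porbit (split2 x y) y.
Proof.
move=> xy; have := porbits_mul_tperm (split2 x y) x y.
rewrite /= mulgA tperm2 mul1g (eqP cc) split2_porbits // xy.
by case: (_ \notin _).
Qed.

(** Multiplying by [tperm x y] splits the long cycle in two, and a transposition
    between the two parts joins them again. *)
Lemma merge_cycle x y z : x != y -> z \notin porbit (split2 x y) x ->
  long_cycle (tperm x z * split2 x y)%g.
Proof.
move=> xy zx; have := porbits_mul_tperm (split2 x y) x z.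
have -> : x != z by apply: contraNneq zx => <-; exact: porbit_id.
rewrite /= porbit_sym zx split2_porbits // => e.
by rewrite /long_cycle -(eqn_add2r 2) e.
Qed.

Definition good3 (u : 'I_n * 'I_n * 'I_n) :=
  [&& u.1.1 != u.1.2, u.2 != u.1.2, u.2 != u.1.1 &
      u.2 \notin porbit (split2 u.1.1 u.1.2) u.1.1].

Lemma rot3 (x y z : 'I_n) : x != y -> z != y -> z != x ->
  let u := (tperm x z * tperm x y)%g in
  [/\ u x = z, u z = y, u y = x & forall a, a != x -> a != y -> a != z -> u a = a].
Proof.
move=> xy zy zx u; rewrite /u; split.
- by rewrite permM tpermL tpermD // eq_sym.
- by rewrite permM tpermR tpermL.
- by rewrite permM (tpermD xy zy) tpermR.
- by move=> a ax ay az; rewrite permM !tpermD // eq_sym.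
Qed.

Lemma sing_good (t : {perm 'I_n}) x y z : good3 (x, y, z) ->
  (c ^ t)%g = (tperm x z * split2 x y)%g ->
  sing c t = [set c x; c y; c z] /\ #|sing c t| = 3.
Proof.
move=> /and4P[/= xy zy zx _] e.
have [ux uz uy ua] := rot3 xy zy zx.
have cE a : [~ c, t]%g (c a) = c ((tperm x z * tperm x y)%g a).
  by rewrite commgEl e !permM permK.
have E : sing c t = [set c x; c y; c z].
  apply/setP => b; rewrite -(permKV c b); set a := (c^-1)%g b.
  rewrite !inE cE !(inj_eq (@perm_inj _ c)).
  case: (eqVneq a x) => [->|ax]; first by rewrite ux zx.
  case: (eqVneq a y) => [->|ay]; first by rewrite uy xy.
  case: (eqVneq a z) => [->|az]; first by rewrite uz eq_sym zy.
  by rewrite ua // eqxx.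
split=> //; rewrite E finset.setUC cardsU1 cards2 !inE !(inj_eq (@perm_inj _ c)).
by rewrite (negPf zx) (negPf zy) xy.
Qed.

(** Two gluings with the same first component c give the same surface only if
    they are conjugate under the centralizer of c. *)
Lemma card_same_surface (B : {set {perm 'I_n}}) :
  (#|B| <= n * #|[set relabelings ((c, t) : gluing n) | t in B]|)%N.
Proof.
apply: card_fibers => X.
case: (set_0Vmem [set t in B | relabelings ((c, t) : gluing n) == X]) => [->|[t0]].
  by rewrite cards0.
rewrite !inE => /andP[_ /eqP e0].
apply: (@leq_trans (size (enum 'I_n))); last by rewrite size_enum_ord.
apply: (card_le_codes x0 (r := fun t i => exists f : {perm 'I_n},
  [/\ (c ^ f)%g = c, t = (t0 ^ f)%g & f x0 = i])).
  move=> t; rewrite !inE => /andP[_ /eqP e].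
  have [f [/esym cf ->]] := proj2 (relabelings_eqP (c, t0) (c, t)) (etrans e0 (esym e)).
  by exists (f x0); [rewrite mem_enum | exists f].
move=> t t' i [f [cf -> fi]] [g [cg -> gi]].
by rewrite (centralizer_eq cc cf cg (etrans fi (esym gi))).
Qed.

(** For each triple and each w there is a t with [t x0 = w] conjugating c into the
    long cycle of the triple.  From t one recovers w, and the triple up to a
    cyclic rotation; each surface comes from at most n of these t. *)
Lemma lower_family (A : {set 'I_n * 'I_n * 'I_n}) (P : gluing n -> Prop) :
  (forall u, u \in A -> good3 u) ->
  (forall t x y z, (x, y, z) \in A -> comb_H2 (c, t) ->
     sing c t = [set c x; c y; c z] -> P (c, t)) ->
  (#|A| <= 3 * num_surfaces P)%N.
Proof.
move=> Ag AP.
have n0 : (0 < n)%N by have := ltn_ord x0; lia.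
pose Q := finset.setX A [set: 'I_n].
have /fin_all_exists [f fP] : forall q : 'I_n * 'I_n * 'I_n * 'I_n,
    exists t : {perm 'I_n}, q.1 \in A ->
    t x0 = q.2 /\ (c ^ t)%g = (tperm q.1.1.1 q.1.2 * split2 q.1.1.1 q.1.1.2)%g.
  case=> -[[x y] z] w /=; case xA: (_ \in A); last by exists 1%g.
  have /and4P[/= xy zy zx zn] := Ag _ xA.
  have [t tP] := long_cycle_conj x0 w cc (merge_cycle xy zn).
  by exists t.
have fQ q : q \in Q -> P (c, f q).
  case: q => [[[x y] z] w]; rewrite finset.inE => /andP[/= xA _].
  have [_ e] := fP (x, y, z, w) xA; have [E c3] := sing_good (Ag _ xA) e.
  apply: AP xA _ E; split=> //; exact: long_cycle_trans.
have le1 : (#|Q| <= 3 * #|[set f q | q in Q]|)%N.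
  apply: card_fibers => t.
  case: (set_0Vmem [set q in Q | f q == t]) => [->|[[[[x y] z] w]]].
    by rewrite cards0.
  rewrite finset.inE => /andP[]; rewrite finset.inE => /andP[/= xA _] /eqP e0.
  have [_ e1] := fP (x, y, z, w) xA.
  have [_ c3] := sing_good (Ag _ xA) e1.
  apply: (@leq_trans (size (enum (sing c t)))); last by rewrite -cardE -e0 c3.
  apply: (card_le_codes x0 (r := fun q a => [/\ q.1 \in A, f q = t & c q.1.1.1 = a])).
    move=> [[[x' y'] z'] w']; rewrite finset.inE => /andP[]; rewrite finset.inE.
    move=> /andP[/= xA' _] /eqP e0'; exists (c x') => //.
    have [_ e1'] := fP (x', y', z', w') xA'.
    have [E _] := sing_good (Ag _ xA') e1'.
    by rewrite mem_enum -e0' E !inE eqxx.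
  move=> [[[a b] d] e] [[[a' b'] d'] e'] i [/= h1 h2 h3] [/= h1' h2' h3'].
  have ea : a = a' by apply: (@perm_inj _ c); rewrite h3 h3'.
  have [/= we ce] := fP (a, b, d, e) h1; have [/= we' ce'] := fP (a', b', d', e') h1'.
  rewrite h2 in we ce; rewrite h2' in we' ce'.
  have /and4P[/= ab db da _] := Ag _ h1; have /and4P[/= ab' db' da' _] := Ag _ h1'.
  have [ux uz _ _] := rot3 ab db da; have [ux' uz' _ _] := rot3 ab' db' da'.
  have eu : (tperm a d * tperm a b = tperm a' d' * tperm a' b')%g.
    by apply: (@mulIg _ c); rewrite -!mulgA -ce -ce'.
  have ed : d = d' by rewrite -ux -ux' eu ea.
  have eb : b = b' by rewrite -uz -uz' eu ed.
  by rewrite ea ed eb -we -we'.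
have le2 := card_same_surface [set f q | q in Q].
have le3 : (#|[set relabelings ((c, t) : gluing n) | t in [set f q | q in Q]]|
   <= num_surfaces P)%N.
  apply: subset_leq_card; apply/fintype.subsetP => _ /imsetP[_ /imsetP[q qQ ->] ->].
  by apply: imset_f; rewrite inE; apply: asboolT; exact: fQ.
move: le1; rewrite cardsX cardsT card_ord => le1.
rewrite -(leq_pmul2r n0); apply: leq_trans le1 _.
rewrite -mulnA leq_mul2l /=; apply: leq_trans le2 _.
by rewrite mulnC leq_mul2r le3 orbT.
Qed.

End Lower.

Lemma ordS_long_cycle N : long_cycle (perm (@ordS_inj N.+1)).
Proof.
set c := perm _.
have it i : (i < N.+1)%N -> iter i c ord0 = i :> nat.
  elim: i => // i IH lt; rewrite iterS permE /= IH; last lia.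
  by rewrite modn_small.
have e x : porbit c x = porbit c ord0.
  apply/eqP; rewrite eq_porbit_mem; apply/porbitP; exists x; rewrite permX.
  by apply: val_inj; rewrite /= it.
apply/cards1P; exists (porbit c ord0); apply/setP => X; rewrite !inE.
apply/imsetP/eqP => [[x _ ->]|->]; first exact: e.
by exists ord0.
Qed.

Section Count.
Variable n : nat.
Variable c : {perm 'I_n}.
Hypothesis cc : long_cycle c.

(** Exchanging x and y exchanges the roles of the two parts of the split cycle,
    and every z other than x and y avoids one of them. *)
Lemma card_good3 : (n * n.-1 * n.-2 <= 2 * #|[set u | good3 c u]|)%N.
Proof.
pose f x y := #|[set z | good3 c (x, y, z)]|.
have cf : #|[set u | good3 c u]| = (\sum_x \sum_y f x y)%N.
  rewrite pair_bigA /= -sum1dep_card.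
  rewrite (eq_bigr (fun u => \sum_(z | good3 c (u.1, u.2, z)) 1)%N); last first.
    by move=> u _; rewrite sum1dep_card.
  by rewrite pair_big_dep /=; apply: eq_bigl => -[[x y] z].
(* Each z other than x and y is good for (x, y) or for (y, x). *)
have ge x y : x != y -> (n.-2 <= f x y + f y x)%N.
  move=> xy; have -> : n.-2 = #|~: [set x; y]|.
    by rewrite cardsCs finset.setCK cards2 xy card_ord subn2.
  rewrite /f -cardsUI; apply: leq_trans (leq_addr _ _).
  apply: subset_leq_card; apply/fintype.subsetP => z; rewrite !inE negb_or /good3 /=.
  have xy' := xy; move=> /andP[zx zy]; rewrite eq_sym in xy.
  rewrite xy' xy zx zy /= (tpermC y x) -negb_and.
  apply/negP => /andP[z1 z2].
  move: z1 z2; rewrite -!eq_porbit_mem => /eqP z1 /eqP z2.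
  by have := split2_notin cc xy'; rewrite -eq_porbit_mem -z1 -z2 eqxx.
(* Add the sum over (x, y, z) to the one with x and y exchanged. *)
rewrite cf mul2n -addnn {2}exchange_big /= -big_split /=.
under eq_bigr do rewrite -big_split /=.
apply: (@leq_trans (\sum_(x : 'I_n) \sum_(y | y != x) n.-2)%N).
  under eq_bigr => x _.
    rewrite sum_nat_const cardC1 card_ord.
    over.
  by rewrite sum_nat_const card_ord mulnA.
apply: leq_sum => x _; rewrite [leqRHS](bigID (fun y => y != x)) /=.
apply: leq_trans (leq_addr _ _); apply: leq_sum => y yx; apply: ge; by rewrite eq_sym.
Qed.

(** When x = c y, the split cycle fixes x, so every remaining z is good. *)
Definition unit3 := [set u : 'I_n * 'I_n * 'I_n |
  [&& u.1.1 == c u.1.2, u.2 != u.1.1 & u.2 != u.1.2]].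

Lemma unit3_good u : (1 < n)%N -> u \in unit3 -> good3 c u.
Proof.
move=> n1; case: u => [[x y] z]; rewrite inE => /and3P[/= /eqP xc zx zy].
have xy : x != y.
  apply/eqP => e; have e1 i : iter i c y = y by elim: i => //= i ->; rewrite -xc.
  have := @long_cycle_inj _ c cc y 0 1; rewrite card_ord !e1 => /(_ ltac:(lia) n1 erefl).
  by [].
rewrite /good3 /= xy zx zy /=; apply/porbitP => -[i zi].
(* The split cycle fixes x, because x = c y. *)
have fx j : (((tperm x y * c) ^+ j)%g x) = x.
  by elim: j => [|j IH]; rewrite ?expg0 ?perm1 // expgSr permM IH permM tpermL -xc.
by move: zx; rewrite zi fx eqxx.
Qed.

Lemma card_unit3 : (1 < n)%N -> #|unit3| = (n * n.-2)%N.
Proof.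
move=> n1; pose S y := [set z | (z != c y) && (z != y)].
have -> : #|unit3| = (\sum_y #|S y|)%N.
  under eq_bigr do rewrite -sum1dep_card.
  rewrite pair_big_dep /= sum1dep_card.
  pose g (p : 'I_n * 'I_n) := (c p.1, p.1, p.2).
  have gi : injective g by case=> a b [a' b'] [_ -> ->].
  rewrite -(card_imset _ gi); apply: eq_card => -[[x y] z]; rewrite inE.
  apply/and3P/imsetP => /= [[/eqP -> zx zy]|[[y' z']]].
    by exists (y, z); rewrite // inE /= zx.
  by rewrite inE => /andP[/= h1 h2] [-> -> ->]; rewrite eqxx.
rewrite (eq_bigr (fun=> n.-2)) ?sum_nat_const ?card_ord // => y _.
have cy : c y != y.
  apply/eqP => e; have e1 i : iter i c y = y by elim: i => //= i ->.
  by have := @long_cycle_inj _ c cc y 0 1; rewrite card_ord !e1 => /(_ ltac:(lia) n1 erefl).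
have -> : S y = ~: [set c y; y] by apply/setP => z; rewrite !inE negb_or.
by rewrite cardsCs finset.setCK cards2 cy card_ord subn2.
Qed.

End Count.

Theorem lower_cubic n : (n * n.-1 * n.-2 <= 6 * num_surfaces (@comb_H2 n))%N.
Proof.
case: n => // n; have cc := ordS_long_cycle n; set c := perm _ in cc.
have le := card_good3 cc.
have := @lower_family _ c cc ord0 [set u | good3 c u] (@comb_H2 n.+1).
have h1 u : u \in [set u | good3 c u] -> good3 c u by rewrite inE.
move=> /(_ h1) h; apply: leq_trans le _; rewrite (_ : 6 = 2 * 3)%N // -mulnA leq_mul2l.
by rewrite h ?orbT.
Qed.

Theorem lower_quadratic n : (n * n.-2 <= 3 *
  num_surfaces (fun o : gluing n => comb_H2 o /\ has_unit o.1 o.2))%N.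
Proof.
case: n => // -[|n]; first by rewrite muln0.
have cc := ordS_long_cycle n.+1; set c := perm _ in cc.
rewrite -(card_unit3 cc) //; apply: (lower_family cc ord0).
  by move=> u; apply: unit3_good.
move=> t x y z; rewrite inE => /and3P[/= /eqP xc _ _] h2 E; split=> //.
by exists x; rewrite /= E !inE ?xc eqxx ?orbT.
Qed.

Import Order.TTheory GRing.Theory Num.Theory.
Local Open Scope ring_scope.

(** * Points, angles and vertices of a square-tiled surface *)

Section Points.
Variables (R : realType) (n : nat) (o : gluing n).
Local Notation s := o.1.
Local Notation t := o.2.
Local Notation turn := [~ o.1, o.2]%g.
Local Notation pt := (sq_point R n).
Implicit Types p q : pt.

(** Coordinates 1 are replaced by 0 by passing to the neighbouring square, so a
    point is normal when its coordinates x satisfy 0 <= x < 1.  The normal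
    representative is unique except at a vertex, where the order in which the
    right and the upper sides are crossed matters. *)
Definition fold01 (x : R) : R := if x == 1 then 0 else x.

Definition normal_pt p : pt :=
  let i := if p.2.1 == 1 then s p.1 else p.1 in
  (if p.2.2 == 1 then t i else i, (fold01 p.2.1, fold01 p.2.2)).

(** The squares containing a normal representative of the point of the surface. *)
Definition normal_squares p : {set 'I_n} :=
  if p.2 == (0, 0) then porbit turn p.1 else [set p.1].

Definition point_class p := (normal_squares (normal_pt p), (normal_pt p).2).

Lemma fold01_bounds x : 0 <= x <= 1 -> 0 <= fold01 x < 1.
Proof.
rewrite /fold01; case: eqP => [_ _|/eqP x1 /andP[-> h]]; first by rewrite lexx ltr01.
by rewrite lt_neqAle x1 h.
Qed.

Lemma glued_in_square p q : glued o p q -> in_square p /\ in_square q.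
Proof. by case=> i x h; rewrite /in_square /= h !lexx ler01. Qed.

Lemma same_in_square p q : same_point o p q -> in_square p = in_square q.
Proof.
by elim=> {p q} // [p q /glued_in_square[-> ->] //|p q r _ -> _ ->].
Qed.

Lemma glued_class p q : glued o p q -> point_class p = point_class q.
Proof.
rewrite /point_class /normal_pt; case=> i x h /=; rewrite /fold01 eqxx.
  by rewrite (eq_sym 0 1) oner_eq0.
rewrite (eq_sym 0 1) oner_eq0; case: (x =P 1) => [_|//].
rewrite /normal_squares eqxx; congr (_, _); apply/eqP.
by rewrite eq_porbit_mem -turnE -{1}(expg1 turn) mem_porbit.
Qed.

Lemma same_class p q : same_point o p q -> point_class p = point_class q.
Proof. by elim=> {p q} // [p q /glued_class //|p q r _ -> _ ->]. Qed.

Lemma same_normal p : in_square p -> same_point o p (normal_pt p).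
Proof.
case: p => i [x y] /andP[/= x01 y01].
apply: (@rst_trans _ _ _ (if x == 1 then s i else i, (fold01 x, y))).
  rewrite /fold01; case: eqP => [->|_]; last exact: rst_refl.
  by apply: rst_step; constructor.
rewrite /normal_pt /= [fold01 y]/fold01; case: (y =P 1) => [->|_]; last exact: rst_refl.
apply: rst_step; constructor.
by have /andP[-> /ltW] := fold01_bounds x01.
Qed.

(** The path around the corner: back across the left side, then across the bottom
    side, then through the two remaining sides. *)
Lemma same_turn i j : j \in porbit turn i -> same_point o ((i, (0, 0)) : pt) (j, (0, 0)).
Proof.
move=> /porbitP[k ->]; elim: k => [|k IH]; first by rewrite expg0 perm1; exact: rst_refl.
apply: rst_trans IH _; rewrite expgSr permM; set a := (turn ^+ k)%g i.
pose b := (t^-1%g (s^-1%g a)).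
have -> : a = s (t b) by rewrite /b !permKV.
rewrite turnE.
have l01 : 0 <= (0 : R) <= 1 by rewrite lexx ler01.
have l11 : 0 <= (1 : R) <= 1 by rewrite lexx ler01.
apply: (@rst_trans _ _ _ (t b, (1, 0))).
  by apply: rst_sym; apply: rst_step; constructor.
apply: (@rst_trans _ _ _ (b, (1, 1))).
  by apply: rst_sym; apply: rst_step; constructor.
apply: (@rst_trans _ _ _ (s b, (0, 1))).
  by apply: rst_step; constructor.
by apply: rst_step; constructor.
Qed.

Lemma class_same p q : in_square p -> in_square q -> point_class p = point_class q -> same_point o p q.
Proof.
move=> ip iq e; have eS : normal_squares (normal_pt p) = normal_squares (normal_pt q) := congr1 fst e.
have ec : (normal_pt p).2 = (normal_pt q).2 := congr1 snd e.
have sp := same_normal ip; have sq := same_normal iq.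
move: sp sq eS ec; rewrite /normal_squares.
case: (normal_pt p) => i a; case: (normal_pt q) => j b /= sp sq + e'; rewrite {}e' in sp *.
case: eqP => [e'|_] ij.
  apply: rst_trans sp _; apply: rst_trans (rst_sym _ _ _ _ sq).
  by rewrite e'; apply: same_turn; rewrite ij porbit_id.
have {}ij : i = j by apply/set1P; rewrite -ij inE.
by apply: rst_trans sp _; rewrite ij; apply: rst_sym.
Qed.

Lemma same_pointE p q : in_square p ->
  same_point o p q <-> in_square q /\ point_class p = point_class q.
Proof.
move=> ip; split=> [h|[iq]]; last exact: class_same.
by rewrite -(same_in_square h) (same_class h).
Qed.

(** The inverse images of x under [fold01] between 0 and 1. *)
Definition lifts (x : R) : seq R := if x == 0 then [:: 0; 1] else [:: x].

Definition lift_sq (i : 'I_n) (c : R * R) : 'I_n :=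
  let j := if c.2 == 1 then t^-1%g i else i in if c.1 == 1 then s^-1%g j else j.

Definition factor (x : R) : R := if (x == 0) || (x == 1) then 2^-1 else 1.

Lemma lifts_fold01 x : 0 <= x <= 1 -> x \in lifts (fold01 x).
Proof.
move=> x01; rewrite /lifts /fold01; case: (x =P 1) => [->|_].
  by rewrite eqxx !inE eqxx orbT.
by case: eqP => [->|_]; rewrite !inE eqxx.
Qed.

Lemma fold01_lifts x a : 0 <= x < 1 -> a \in lifts x -> fold01 a = x /\ 0 <= a <= 1.
Proof.
move=> /andP[x0 x1]; rewrite /lifts /fold01; case: (x =P 0) => [->|_].
  by rewrite !inE => /orP[] /eqP ->; rewrite ?eqxx ?lexx ?ler01 ?(eq_sym 0) ?oner_eq0.
by rewrite inE => /eqP ->; rewrite x0 (ltW x1) (lt_eqF x1).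
Qed.

(** The angle of a square at a point is a product over the two coordinates, and in
    each coordinate the halves at the two ends add up to 1. *)
Lemma sum_lifts x : x < 1 -> \sum_(a <- lifts x) factor a = 1.
Proof.
move=> x1; rewrite /lifts /factor; case: eqP => [_|/eqP x0].
  by rewrite !big_cons big_nil !eqxx orbT /=; lra.
by rewrite big_seq1 (negPf x0) (lt_eqF x1).
Qed.

Lemma uniq_lifts x : uniq (lifts x).
Proof. by rewrite /lifts; case: ifP => //= _; rewrite inE eq_sym oner_eq0. Qed.

Lemma normal_lift i c : normal_pt (lift_sq i c, c) = (i, (fold01 c.1, fold01 c.2)).
Proof.
rewrite /normal_pt /lift_sq /=.
by case: eqP => _; case: eqP => _; rewrite ?permKV.
Qed.

Lemma lift_normal p : lift_sq (normal_pt p).1 p.2 = p.1.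
Proof.
by rewrite /normal_pt /lift_sq /=; case: eqP => _; case: eqP => _; rewrite ?permK.
Qed.

(** Each normal square of the point accounts for the angle 2 pi, distributed over
    the squares that meet it at a side or a corner. *)
Lemma total_angleE p : in_square p ->
  total_angle o p = #|normal_squares (normal_pt p)|%:R * (2 * pi).
Proof.
move=> ip; have /andP[px py] := ip.
pose S := normal_squares (normal_pt p); set x := fold01 p.2.1; set y := fold01 p.2.2.
have x01 : 0 <= x < 1 := fold01_bounds px; have y01 : 0 <= y < 1 := fold01_bounds py.
pose L := [seq (lift_sq k c, c) | k <- enum S,
             c <- [seq (a, b) | a <- lifts x, b <- lifts y]].
have uL : uniq L.
  apply: allpairs_uniq; first exact: enum_uniq.
    by apply: allpairs_uniq; rewrite ?uniq_lifts // => -[a b] [a' b'].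
  move=> [k c] [k' c'] _ _ /= [h e]; rewrite -{}e /lift_sq in h *; congr (_, _).
  move: h; case: (c.1 == 1); case: (c.2 == 1).
  - by move=> /perm_inj /perm_inj.
  - by move=> /perm_inj.
  - by move=> /perm_inj.
  - by [].
have -> : total_angle o p = \sum_(q <- L) sq_angle q.
  rewrite fsbig_seq // /total_angle; apply: eq_fsbigl; apply/predeqP => q /=; split.
    move=> /(proj1 (same_pointE _ ip)) [iq e].
    have eS : normal_squares (normal_pt p) = normal_squares (normal_pt q) := congr1 fst e.
    have [ex ey] : (normal_pt p).2 = (normal_pt q).2 := congr1 snd e.
    apply/allpairsP; exists ((normal_pt q).1, q.2); split.
    - rewrite mem_enum /S eS /normal_squares -[(_, _).1]/((normal_pt q).1).
      by case: ifP => _; rewrite ?porbit_id // finset.inE.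
    - have /andP[qx qy] := iq; case: (q) ex ey qx qy => i [a b] /= ex ey qx qy.
      by apply: allpairs_f; rewrite /x /y ?ex ?ey; exact: lifts_fold01.
    - by rewrite -[(_, _).1]/((normal_pt q).1) -[(_, _).2]/(q.2) lift_normal; case: (q).
  move=> /allpairsP[[k c] [/= kS /allpairsP[[a b] [/= ha hb ->]] ->]].
  have [wa a01] := fold01_lifts x01 ha; have [wb b01] := fold01_lifts y01 hb.
  apply/same_pointE => //; split; first by rewrite /in_square /= a01 b01.
  rewrite /point_class normal_lift /= wa wb; congr (_, _).
  rewrite /normal_squares /=; move: kS; rewrite mem_enum /S /normal_squares /=.
  case: eqP => // _.
    by rewrite -eq_porbit_mem => /eqP ->.
  by move=> /set1P ->.
rewrite big_allpairs_dep /=.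
under eq_bigr => k _.
  rewrite big_allpairs_dep /=.
  under eq_bigr => a _.
    rewrite /sq_angle /= -/(factor a).
    under eq_bigr => b _ do rewrite -/(factor b).
    rewrite -big_distrl -big_distrr /= sum_lifts; last by case/andP: y01.
    rewrite mulr1.
    over.
  rewrite -big_distrl /= sum_lifts; last by case/andP: x01.
  rewrite mul1r.
  over.
by rewrite big_enum /= sumr_const [RHS]mulr_natl.
Qed.

End Points.

Lemma porbit_sub (T : finType) (u : {perm T}) (A : {set T}) x :
  (forall y, y \in A -> u y \in A) -> x \in A -> porbit u x \subset A.
Proof.
move=> uA xA; apply/fintype.subsetP => _ /porbitP[k ->].
by elim: k => [|k IH]; rewrite ?expg0 ?perm1 // expgSr permM uA.
Qed.

Lemma card_porbit1 (T : finType) (u : {perm T}) x :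
  (#|porbit u x| == 1%N) = (u x == x).
Proof.
apply/cards1P/eqP => [[y e]|e].
  have /set1P e1 : u x \in [set y] by rewrite -e -{1}(expg1 u) mem_porbit.
  have /set1P e2 : x \in [set y] by rewrite -e porbit_id.
  by rewrite e1 -e2.
exists x; apply/setP => y; rewrite inE; apply/idP/eqP => [|->]; last exact: porbit_id.
have /fintype.subsetP sub : porbit u x \subset [set x].
  by apply: porbit_sub => [y' /set1P ->|]; rewrite ?e inE.
by move=> /sub /set1P.
Qed.

Section ConePoints.
Variables (R : realType) (n : nat) (o : gluing n).
Local Notation s := o.1.
Local Notation t := o.2.
Local Notation turn := [~ o.1, o.2]%g.
Local Notation pt := (sq_point R n).
Implicit Types p q : pt.

(** A cycle of the commutator of length 1 is a regular vertex. *)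
Lemma cone_pointE p : cone_point o p <->
  [/\ in_square p, (normal_pt o p).2 = (0, 0) & (normal_pt o p).1 \in sing s t].
Proof.
have tpi : 2 * pi != 0 :> R by rewrite mulf_neq0 ?pnatr_eq0 // gt_eqF ?pi_gt0.
have angle m : (m%:R * (2 * pi) = 2 * pi :> R) <-> m = 1%N.
  split=> [|->]; last by rewrite mul1r.
  rewrite -[RHS]mul1r => /(mulIf tpi) /eqP.
  by rewrite -[1 in eqbRHS]/(1%:R) eqr_nat => /eqP.
rewrite /cone_point; split=> [[ip]|[ip e st]].
  rewrite total_angleE // angle /normal_squares.
  case: eqP => e; last by rewrite cards1.
  by move=> /eqP; rewrite card_porbit1 => h; split; rewrite ?finset.inE.
split=> //; rewrite total_angleE // angle /normal_squares e eqxx => /eqP.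
by rewrite card_porbit1; move: st; rewrite finset.inE => /negPf ->.
Qed.

Lemma cone_same p q : same_point o p q -> cone_point o p -> cone_point o q.
Proof.
move=> h [ip ap]; have iq := same_in_square h; split; first by rewrite -iq.
have ek := congr1 (fun k => k.1) (same_class h); rewrite /= in ek.
by rewrite total_angleE -?iq // -ek -total_angleE.
Qed.

Definition origin (i : 'I_n) : pt := (i, (0, 0)).

Lemma in_square_origin i : in_square (origin i).
Proof. by rewrite /in_square /= lexx ler01. Qed.

Lemma normal_origin i : normal_pt o (origin i) = origin i.
Proof. by rewrite /normal_pt /origin /= /fold01 (eq_sym 0 1) oner_eq0. Qed.

Lemma cone_origin i : cone_point o (origin i) <-> i \in sing s t.
Proof.
rewrite cone_pointE normal_origin; split=> [[]//|h]; split=> //.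
exact: in_square_origin.
Qed.

Lemma sing_porbit i j : #|sing s t| = 3%N -> i \in sing s t ->
  (j \in porbit turn i) = (j \in sing s t).
Proof.
move=> P3 iP; have [PE _ _ _] := turn_cycle P3 iP.
apply/idP/idP; first move: j; last first.
  rewrite PE => /finset.setUP[/set2P[->|->]|/set1P ->].
  - exact: porbit_id.
  - by rewrite -{1}(expg1 turn) mem_porbit.
  - by rewrite -permM -expg2 mem_porbit.
apply/fintype.subsetP/porbit_sub => // y; by rewrite sing_turn.
Qed.

(** The three singular squares form one cycle and all others are fixed. *)
Lemma card_porbits_sing : #|sing s t| = 3%N -> #|porbits turn| = (n - 2)%N.
Proof.
move=> P3; have [i iP] : exists i, i \in sing s t by apply/card_gt0P; rewrite P3.
have PO : porbit turn i = sing s t by apply/setP => j; exact: sing_porbit.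
have E : porbits turn = sing s t |: [set [set x] | x in ~: sing s t].
  apply/setP => X; apply/imsetP/setU1P => [[x _ ->]|[->|/imsetP[x xP ->]]].
  - case xP: (x \in sing s t); [left|right].
      by apply/setP => j; exact: sing_porbit.
    have xf : x \in ~: sing s t by rewrite finset.inE xP.
    apply/imsetP; exists x => //.
    apply/eqP; rewrite eq_sym eqEcard finset.sub1set porbit_id /= cards1.
    by rewrite (eqP (_ : #|porbit turn x| == 1%N)) // card_porbit1 (notin_sing (negbT xP)).
  - by exists i.
  exists x => //; apply/eqP; rewrite eqEcard finset.sub1set porbit_id /= cards1.
  rewrite finset.inE in xP.
  by rewrite (eqP (_ : #|porbit turn x| == 1%N)) // card_porbit1 (notin_sing xP).
rewrite E cardsU1 (card_imset _ set1_inj) cardsCs finset.setCK P3 card_ord.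
have -> : sing s t \notin [set [set x] | x in ~: sing s t].
  by apply/imsetP => -[x _ e]; move: P3; rewrite e cards1.
have : (#|sing s t| <= n)%N by rewrite -[leqRHS]card_ord max_card.
by rewrite P3 /=; lia.
Qed.

Lemma num_verticesE : num_vertices R o = #|porbits turn|.
Proof.
pose rep (c : 'I_n * (bool * bool)) := (normal_pt o (corner R c)).1.
have repE c : normal_pt o (corner R c) = origin (rep c).
  rewrite /rep; case: c => i [a b]; rewrite /normal_pt /corner /origin /= /fold01.
  by case: a; case: b; rewrite /= ?eqxx ?(eq_sym 0 1) ?oner_eq0.
have inc c : in_square (corner R c).
  by case: c => i [[] []]; rewrite /in_square /= ?lexx ?ler01.
have sameE c d : `[< same_point o (corner R c) (corner R d) >] =
    (porbit turn (rep c) == porbit turn (rep d)).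
  apply/asboolP/eqP => [/same_class|e].
    by rewrite /point_class !repE /normal_squares /= !eqxx => -[].
  by apply: class_same => //; rewrite /point_class !repE /normal_squares /= eqxx e.
have rep_surj i : rep (i, (false, false)) = i.
  by rewrite /rep /normal_pt /= /fold01 (eq_sym 0 1) oner_eq0.
pose G (X : {set 'I_n}) := [set d | rep d \in X].
have Ginj : injective G.
  move=> X Y e; apply/setP => i; have := congr1 (fun Z : {set _} => (i, (false, false)) \in Z) e.
  by rewrite !finset.inE rep_surj.
rewrite /num_vertices -(card_imset _ Ginj).
apply: eq_card => X; apply/imsetP/imsetP.
  move=> [c _ ->]; exists (porbit turn (rep c)); first by apply: imset_f.
  apply/setP => d; rewrite !finset.inE /= sameE eq_porbit_mem porbit_sym.
  by [].
move=> [_ /imsetP[i _ ->] ->]; exists (i, (false, false)); first by rewrite finset.inE.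
by apply/setP => d; rewrite !finset.inE /= sameE rep_surj eq_porbit_mem porbit_sym.
Qed.

Lemma in_H2E : in_H2 R o <-> comb_H2 o.
Proof.
split=> [[tr _ [p [/cone_pointE[ip e st] ap uniq]]]|[tr P3]].
  split=> //; move: ap; rewrite total_angleE // /normal_squares e eqxx.
  have pi0 : (pi : R) != 0 by rewrite gt_eqF ?pi_gt0.
  rewrite mulrA => /(mulIf pi0) h.
  have c3 : #|porbit turn (normal_pt o p).1| = 3%N.
    by apply/eqP; rewrite -(eqr_nat R); apply/eqP; lra.
  rewrite -c3; apply/eqP; rewrite eqn_leq !subset_leq_card //.
    by apply: porbit_sub => // y; rewrite sing_turn.
  apply/fintype.subsetP => k kP.
  have /same_class := uniq _ (proj2 (cone_origin k) kP).
  move=> /(congr1 (fun z => z.1)) /=; rewrite normal_origin /normal_squares e /= !eqxx => ->.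
  exact: porbit_id.
have [i iP] : exists i, i \in sing s t by apply/card_gt0P; rewrite P3.
have n3 : (3 <= n)%N by rewrite -P3 -[leqRHS]card_ord max_card.
have PO : porbit turn i = sing s t by apply/setP => j; exact: sing_porbit.
split=> //.
  rewrite /has_genus /euler_characteristic num_verticesE card_porbits_sing //; lia.
exists (origin i); split.
- exact/cone_origin.
- rewrite total_angleE ?in_square_origin // normal_origin /normal_squares eqxx PO P3; lra.
move=> q /cone_pointE[iq e qP]; apply: class_same => //; first exact: in_square_origin.
rewrite /point_class normal_origin e; congr (_, _).
rewrite /normal_squares e !eqxx; apply/eqP.
by rewrite eq_porbit_mem porbit_sym sing_porbit.
Qed.

End ConePoints.

(** * Unit saddles *)

(** Induction on a real interval: consider the supremum of the initial segments on
    which the property holds. *)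
Lemma real_interval_ind (R : realType) (L : R) (Q : R -> Prop) : 0 <= L -> Q 0 ->
  (forall a, 0 <= a < L -> Q a ->
     exists2 e, 0 < e & forall b, 0 <= b <= e -> a + b <= L -> Q (a + b)) ->
  (forall a, 0 < a <= L -> (forall b, 0 <= b < a -> Q b) -> Q a) ->
  forall a, 0 <= a <= L -> Q a.
Proof.
move=> L0 Q0 step lim.
pose S : set R := [set a | 0 <= a <= L /\ forall b, 0 <= b <= a -> Q b]%classic.
have S0 : S 0.
  split; first by rewrite lexx.
  by move=> b b0; have -> : b = 0 by apply/eqP; rewrite eq_le andbC.
have supS : has_sup S.
  by split; [exists 0 | exists L => a [/andP[]]].
set m := sup S.
have m0 : 0 <= m by exact: (sup_upper_bound supS).
have mL : m <= L by apply: ge_sup => [|a [/andP[]]//]; exists 0.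
have below b : 0 <= b < m -> Q b.
  move=> /andP[b0 bm]; have [a [_ aQ] ba] := sup_adherent (eps := m - b) ltac:(by rewrite subr_gt0) supS.
  by apply: aQ; rewrite b0 /=; rewrite opprB addrC subrK in ba; exact: ltW.
have Qm : Q m.
  move: m0; rewrite le_eqVlt => /orP[/eqP <-//|m0].
  by apply: lim => //; rewrite m0.
have upto b : 0 <= b <= m -> Q b.
  move=> /andP[b0]; rewrite le_eqVlt => /orP[/eqP ->//|bm].
  by apply: below; rewrite b0.
suff -> : L = m by [].
apply/eqP; rewrite eq_le mL andbT leNgt; apply/negP => lt.
have [e e0 eQ] := step m ltac:(by rewrite m0) Qm.
(* If m < L, the property extends beyond the supremum. *)
pose d := Num.min e (L - m).
have d0 : 0 < d by rewrite lt_min e0 subr_gt0.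
have : m + d <= m.
  apply: (sup_upper_bound supS); split.
    rewrite addr_ge0 ?(ltW d0) //= -lerBrDl; by rewrite ge_min lexx orbT.
  move=> b /andP[b0 bd]; case: (leP b m) => bm; first by apply: upto; rewrite b0.
  rewrite -(subrK m b) addrC; apply: eQ.
    rewrite subr_ge0 (ltW bm) /= lerBlDl; apply: le_trans bd _.
    by rewrite lerD2l ge_min lexx.
  apply: le_trans (_ : m + d <= L); first by rewrite addrC subrK.
  by rewrite -lerBrDl ge_min lexx orbT.
by rewrite gerDl leNgt d0.
Qed.

Section Paths.
Variables (R : realType) (n : nat) (o : gluing n).
Local Notation s := o.1.
Local Notation t := o.2.
Local Notation pt := (sq_point R n).
Implicit Types p q : pt.

Lemma same_int p q : same_point o p q ->
  q.2.1 - p.2.1 \is a Num.int /\ q.2.2 - p.2.2 \is a Num.int.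
Proof.
elim=> {p q} [p q [i y _|i x _]|p|p q _ [h1 h2]|p q r _ [h1 h2] _ [h3 h4]] /=.
- by rewrite sub0r subrr rpredN !rpred1 !rpred0.
- by rewrite sub0r subrr rpredN !rpred1 !rpred0.
- by rewrite !subrr !rpred0.
- by rewrite -opprB rpredN h1 -opprB rpredN h2.
have -> : r.2.1 - p.2.1 = (q.2.1 - p.2.1) + (r.2.1 - q.2.1) by ring.
have -> : r.2.2 - p.2.2 = (q.2.2 - p.2.2) + (r.2.2 - q.2.2) by ring.
by split; apply: rpredD.
Qed.

(** Gluings are integral translations, so the coordinates along a path advance
    linearly modulo 1, first locally and then on the whole interval. *)
Lemma path_int (u v L : R) g : 0 <= L -> straight_path o u v L g ->
  forall a, 0 <= a <= L ->
    (g a).2.1 - (g 0).2.1 - a * u \is a Num.int /\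
    (g a).2.2 - (g 0).2.2 - a * v \is a Num.int.
Proof.
move=> L0 [fw bw]; apply: real_interval_ind => //.
- by rewrite !subrr !mul0r subr0 rpred0.
- move=> a aL [h1 h2]; have [e [p [e0 ep]]] := fw a aL; exists e => // b be _.
  have [_ /same_int /= [k1 k2]] := ep b be.
  have [_ /same_int /=] := ep 0 ltac:(by rewrite lexx ltW).
  rewrite !mul0r !addr0 => -[k3 k4]; split.
    have -> : (g (a + b)).2.1 - (g 0).2.1 - (a + b) * u =
      ((g a).2.1 - (g 0).2.1 - a * u) + (p.2.1 - (g a).2.1) -
      (p.2.1 + b * u - (g (a + b)).2.1) by ring.
    by rewrite rpredB // rpredD.
  have -> : (g (a + b)).2.2 - (g 0).2.2 - (a + b) * v =
    ((g a).2.2 - (g 0).2.2 - a * v) + (p.2.2 - (g a).2.2) -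
    (p.2.2 + b * v - (g (a + b)).2.2) by ring.
  by rewrite rpredB // rpredD.
move=> a /[dup] aL /andP[a0 _] IH; have [e [p [e0 ep]]] := bw a aL.
pose b := - Num.min e a.
have m0 : 0 < Num.min e a by rewrite lt_min e0 a0.
have b0 : b < 0 by rewrite oppr_lt0.
have be : - e <= b <= 0 by rewrite (ltW b0) lerN2 ge_min lexx.
have ba : 0 <= a + b < a by rewrite gtrDl b0 andbT /b subr_ge0 ge_min lexx orbT.
have [h1 h2] := IH _ ba.
have [_ /same_int /= [k1 k2]] := ep b be.
have [_ /same_int /=] := ep 0 ltac:(by rewrite lexx oppr_le0 ltW).
rewrite !mul0r !addr0 => -[k3 k4]; split.
  have -> : (g a).2.1 - (g 0).2.1 - a * u =
    ((g (a + b)).2.1 - (g 0).2.1 - (a + b) * u) + (p.2.1 + b * u - (g (a + b)).2.1)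
     - (p.2.1 - (g a).2.1) by ring.
  by rewrite rpredB // rpredD.
have -> : (g a).2.2 - (g 0).2.2 - a * v =
  ((g (a + b)).2.2 - (g 0).2.2 - (a + b) * v) + (p.2.2 + b * v - (g (a + b)).2.2)
   - (p.2.2 - (g a).2.2) by ring.
by rewrite rpredB // rpredD.
Qed.

(** A point with abscissa strictly between 0 and 1 is identified with others across
    horizontal sides only, so the whole segment at its height goes along. *)
Lemma row_class p q : same_point o p q -> (0 < p.2.1 < 1) || (0 < q.2.1 < 1) ->
  p.2.1 = q.2.1 /\ forall x, 0 <= x <= 1 ->
    same_point o (p.1, (x, p.2.2)) (q.1, (x, q.2.2)).
Proof.
elim=> {p q} [p q [i y _|i x _]|p|p q _ IH|p q r _ IH1 _ IH2] /=.
- by rewrite !ltxx andbF.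
- by move=> _; split=> // x' x01; apply: rst_step; constructor.
- by move=> _; split=> // x _; exact: rst_refl.
- by rewrite orbC => /IH[-> h]; split=> // x /h; exact: rst_sym.
move=> h; have hq : 0 < q.2.1 < 1.
  case/orP: h => h; first by have [<-] := IH1 ltac:(by rewrite h).
  by have [->] := IH2 ltac:(by rewrite h orbT).
have [e1 f1] := IH1 ltac:(by rewrite hq orbT).
have [e2 f2] := IH2 ltac:(by rewrite hq).
split; first by rewrite e1.
by move=> x x01; apply: rst_trans (f1 x x01) (f2 x x01).
Qed.

Lemma corner_coord p : cone_point o p ->
  (p.2.1 == 0) || (p.2.1 == 1) /\ (p.2.2 == 0) || (p.2.2 == 1).
Proof.
have fold0 x : fold01 x = 0 :> R -> (x == 0) || (x == 1).
  by rewrite /fold01; case: (x == 1) => [|/eqP ->] //; rewrite orbT.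
by move=> /cone_pointE[_ [/fold0 h1 /fold0 h2] _].
Qed.

(** The path leaves a corner along a horizontal side of a square, and it cannot
    leave this side before time 1. *)
Lemma right_path (g : R -> pt) : straight_path o 1 0 1 g -> cone_point o (g 0) ->
  cone_point o (g 1) -> has_unit s t.
Proof.
move=> [fw bw] c0 c1.
have [e0 [p [e0p ep]]] := fw 0 ltac:(by rewrite lexx ltr01).
have ep' b : 0 <= b <= e0 -> in_square (p.1, (p.2.1 + b, p.2.2)) /\
    same_point o (g b) (p.1, (p.2.1 + b, p.2.2)).
  by move=> be; have := ep b be; rewrite /Defs.shift mulr1 mulr0 addr0 add0r.
have [_] := ep' 0 ltac:(by rewrite lexx ltW); rewrite addr0 => g0p.
case: p => i [x y] /= in ep' g0p {ep} *.
have cp := cone_same g0p c0.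
have [/= hx hy] := corner_coord cp.
have x0 : x = 0.
  case/orP: hx => /eqP // x1; have [] := ep' e0 ltac:(by rewrite lexx ltW).
  by rewrite x1 => /andP[/andP[/= _ h] _] _; lra.
rewrite {}x0 {hx} in cp ep' g0p.
have run a : 0 <= a <= 1 -> same_point o (g a) (i, (a, y)).
  move: a; apply: real_interval_ind => //.
  - move=> a; case: (eqVneq a 0) => [-> _ _|an /andP[a0 a1] ga].
      exists e0 => // b be _; rewrite add0r.
      by have [_] := ep' b be; rewrite add0r.
    have ai : 0 < a < 1 by rewrite a1 lt_def an a0.
    have [e [q [ep0 eq]]] := fw a ltac:(by rewrite a0 a1).
    exists e => // b be b1.
    have [_] := eq b be; rewrite /Defs.shift mulr1 mulr0 addr0.
    have [_] := eq 0 ltac:(by rewrite lexx ltW).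
    rewrite /Defs.shift !mul0r !addr0 => gq h; apply: rst_trans h _; apply: rst_sym.
    have iq : same_point o (i, (a, y)) (q.1, (q.2.1, q.2.2)).
      by apply: rst_trans gq; apply: rst_sym.
    have [/= <- f] := row_class iq ltac:(by rewrite /= ai).
    apply: f; rewrite b1 addr_ge0 //; by case/andP: be.
  - move=> a /[dup] a01 /andP[a0 a1] IH.
    have [e [q [ep0 eq]]] := bw a a01.
    (* Halving a keeps the time a + b positive, strictly inside the side. *)
    pose b := - Num.min e (a / 2).
    have m0 : 0 < Num.min e (a / 2) by rewrite lt_min ep0 divr_gt0.
    have b0 : b < 0 by rewrite oppr_lt0.
    have be : - e <= b <= 0 by rewrite (ltW b0) lerN2 ge_min lexx.
    have bh : - (a / 2) <= b by rewrite lerN2 ge_min lexx orbT.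
    have ba : 0 < a + b < a by apply/andP; split; lra.
    have ab1 : 0 < a + b < 1 by apply/andP; split; lra.
    have gb := IH (a + b) ltac:(by case/andP: ba => /ltW -> ->).
    have [_] := eq b be; rewrite /Defs.shift mulr1 mulr0 addr0.
    have [_] := eq 0 ltac:(by rewrite lexx oppr_le0 ltW).
    rewrite /Defs.shift !mul0r !addr0 => gq h.
    have iq : same_point o (i, (a + b, y)) (q.1, (q.2.1 + b, q.2.2)).
      by apply: rst_trans h; apply: rst_sym.
    have [/= ex f] := row_class iq ltac:(by rewrite /= ab1).
    have {}ex : a = q.2.1 by apply: (addIr b).
    apply: rst_trans gq _; rewrite -ex; apply: rst_sym; apply: f.
    by rewrite (ltW a0).
have c1' := cone_same (run 1 ltac:(by rewrite lexx ler01)) c1.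
move: cp c1' => /cone_pointE[_ _ +] /cone_pointE[_ _ +].
rewrite /normal_pt /= (eq_sym 0 1) oner_eq0 eqxx.
case/orP: hy => /eqP ->; rewrite ?eqxx ?(eq_sym 0 1) ?oner_eq0 => h1 h2.
  by exists i.
by exists (t i) => //; rewrite -sing_turn turnE.
Qed.

Lemma path_rev (u v L : R) g : straight_path o u v L g ->
  straight_path o (- u) (- v) L (fun a => g (L - a)).
Proof.
move=> [fw bw]; split=> a /andP[a0 aL].
  have [e [p [e0 ep]]] := bw (L - a) ltac:(by rewrite subr_gt0 aL gerBl).
  exists e, p; split=> // b /andP[b0 be].
  have := ep (- b) ltac:(by rewrite lerN2 be oppr_le0).
  by rewrite /Defs.shift !mulNr !mulrN opprD addrA.
have [e [p [e0 ep]]] := fw (L - a) ltac:(by rewrite subr_ge0 aL gtrBl).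
exists e, p; split=> // b /andP[b0 be].
have := ep (- b) ltac:(by rewrite oppr_ge0 be lerNl).
by rewrite /Defs.shift !mulNr !mulrN opprD addrA.
Qed.

End Paths.

Section Transpose.
Variables (R : realType) (n : nat).
Implicit Types (o : gluing n) (p q : sq_point R n).

Definition transpose p : sq_point R n := (p.1, (p.2.2, p.2.1)).

Lemma same_transpose o p q :
  same_point o p q -> same_point (swap o) (transpose p) (transpose q).
Proof.
elim=> {p q} [p q [i y h|i x h]|p|p q _|p q r _ h1 _ h2].
- by apply: rst_step; exact: (@glued_up _ _ (swap o) i y h).
- by apply: rst_step; exact: (@glued_right _ _ (swap o) i x h).
- exact: rst_refl.
- exact: rst_sym.
- exact: rst_trans h1 h2.
Qed.

Lemma in_square_transpose p : in_square (transpose p) = in_square p.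
Proof. by rewrite /in_square andbC. Qed.

Lemma path_transpose o (u v L : R) g : straight_path o u v L g ->
  straight_path (swap o) v u L (fun a => transpose (g a)).
Proof.
move=> [fw bw]; split=> a aL.
  have [e [p [e0 ep]]] := fw a aL; exists e, (transpose p); split=> // b be.
  have [h1 h2] := ep b be; rewrite -[Defs.shift _ _ _ _]/(transpose (Defs.shift p u v b)).
  by rewrite in_square_transpose; split=> //; exact: same_transpose.
have [e [p [e0 ep]]] := bw a aL; exists e, (transpose p); split=> // b be.
have [h1 h2] := ep b be; rewrite -[Defs.shift _ _ _ _]/(transpose (Defs.shift p u v b)).
by rewrite in_square_transpose; split=> //; exact: same_transpose.
Qed.

Lemma cone_transpose o p : cone_point o p -> cone_point (swap o) (transpose p).
Proof.
move=> /cone_pointE[ip e h]; apply/cone_pointE; rewrite in_square_transpose; split=> //.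
  by move: e; rewrite /normal_pt /= => -[-> ->].
move: h; rewrite /normal_pt /= (sing_swap o.1).
case: eqP => _; case: eqP => _ //.
by rewrite -(turnE o.1 o.2 p.1) sing_turn.
Qed.

End Transpose.

Lemma int_unit (x y : int) : x ^+ 2 + y ^+ 2 = 1 ->
  [\/ x = 1 /\ y = 0, x = -1 /\ y = 0, x = 0 /\ y = 1 | x = 0 /\ y = -1].
Proof.
move=> h; have : (x = 1 /\ y = 0) \/ (x = -1 /\ y = 0) \/ (x = 0 /\ y = 1) \/ (x = 0 /\ y = -1) by nia.
by case=> [|[|[|]]] ?; [constructor 1|constructor 2|constructor 3|constructor 4].
Qed.

Theorem unit_saddle_has_unit (R : realType) n (o : gluing n) :
  has_unit_saddle R o -> has_unit o.1 o.2 \/ has_unit o.2 o.1.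
Proof.
move=> [g [_ [u [v [uv path c0 c1 _]]]]].
have l1 : 0 <= (1 : R) <= 1 by rewrite lexx ler01.
have [hu hv] := path_int ler01 path l1.
have ci (p : sq_point R n) : cone_point o p -> p.2.1 \is a Num.int /\ p.2.2 \is a Num.int.
  by move=> /corner_coord[/orP[]/eqP -> /orP[]/eqP ->]; rewrite ?rpred1 ?rpred0.
have [i1 i2] := ci _ c0; have [j1 j2] := ci _ c1.
have {hu} /intrP[x xu] : u \is a Num.int.
  have -> : u = (g 1).2.1 - (g 0).2.1 - ((g 1).2.1 - (g 0).2.1 - 1 * u) by ring.
  by rewrite rpredB // rpredB.
have {hv} /intrP[y yv] : v \is a Num.int.
  have -> : v = (g 1).2.2 - (g 0).2.2 - ((g 1).2.2 - (g 0).2.2 - 1 * v) by ring.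
  by rewrite rpredB // rpredB.
have /int_unit cases : x ^+ 2 + y ^+ 2 = 1.
  by apply: (@intr_inj R); rewrite rmorphD !rmorphXn /= -xu -yv uv.
have rev : straight_path o (- u) (- v) 1 (fun a => g (1 - a)) := path_rev path.
have r0 : g (1 - 0) = g 1 by rewrite subr0.
have r1 : g (1 - 1) = g 0 by rewrite subrr.
case: cases => -[xe ye]; rewrite {}xe in xu; rewrite {}ye in yv;
  rewrite {}xu {}yv ?mulrN1z ?opprK ?oppr0 in path rev.
- by left; apply: (right_path path).
- by left; apply: (right_path rev); rewrite ?r0 ?r1.
- by right; apply: (right_path (path_transpose path)); exact: cone_transpose.
- by right; apply: (right_path (path_transpose rev)); apply: cone_transpose; rewrite ?r0 ?r1.
Qed.

Theorem unit_has_unit_saddle (R : realType) n (o : gluing n) :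
  has_unit o.1 o.2 -> has_unit_saddle R o.
Proof.
move=> [i iP siP]; exists (fun a => (i, (a, 0))); split; first exact: ltr01.
have sq a b : 0 <= a + b <= 1 -> in_square (Defs.shift ((i, (a, 0)) : sq_point R n) 1 0 b) /\
    same_point o ((i, (a + b, 0)) : sq_point R n) (Defs.shift (i, (a, 0)) 1 0 b).
  move=> h; rewrite /Defs.shift /in_square /= mulr1 mulr0 addr0 h lexx ler01.
  by split=> //; exact: rst_refl.
exists 1, 0; split; first by ring.
- split=> a /andP[a0 a1].
    exists (1 - a), (i, (a, 0)); split; first by rewrite subr_gt0.
    by move=> b /andP[b0 b1]; apply: sq; rewrite addr_ge0 //= -lerBrDl.
  exists a, (i, (a, 0)); split=> // b /andP[b0 b1]; apply: sq; apply/andP; split; lra.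
- exact/cone_origin.
- apply/cone_pointE; rewrite /normal_pt /fold01 /= eqxx (eq_sym 0 1) oner_eq0; split=> //.
  by rewrite /in_square /= !lexx ler01.
move=> a /andP[a0 a1] /corner_coord[/= h _]; move: h.
by rewrite (gt_eqF a0) (lt_eqF a1).
Qed.

(** * The growth rates *)

Theorem theorem5p1 (R : realType) :
  Theta (fun n : nat => (num_surfaces (fun o : gluing n => in_H2 R o))%:R : R)
        (fun n : nat => n%:R ^+ 3)
  /\
  Theta (fun n : nat =>
           (num_surfaces (fun o : gluing n =>
              in_H2 R o /\ has_unit_saddle R o))%:R : R)
        (fun n : nat => n%:R ^+ 2).
Proof.
split.
  exists 16^-1, 4, 4%N; split; [lra | lra | move=> n n4; split].
    have h : (num_surfaces (@comb_H2 n) <=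
              num_surfaces (fun o : gluing n => in_H2 R o))%N.
      by apply: num_surfaces_le => o /in_H2E; apply.
    (* For n >= 4 one has 8 (n - 1) (n - 2) >= 3 n^2, hence the factor 16 = 6 * 8 / 3. *)
    have : (n ^ 3 <= 16 * num_surfaces (fun o : gluing n => in_H2 R o))%N.
      by have := lower_cubic n; nia.
    by rewrite -(ler_nat R) natrM natrX; lra.
  rewrite -natrX -natrM ler_nat; apply: leq_trans (upper_cubic n).
  by apply: num_surfaces_le => o /in_H2E.
exists 6^-1, 24, 4%N; split; [lra | lra | move=> n n4; split].
  have h : (num_surfaces (fun o : gluing n => comb_H2 o /\ has_unit o.1 o.2) <=
     num_surfaces (fun o : gluing n => in_H2 R o /\ has_unit_saddle R o))%N.
    apply: num_surfaces_le => o [/in_H2E h2 u]; split; first exact: h2.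
    exact: unit_has_unit_saddle.
  (* For n >= 4 one has 2 (n - 2) >= n, hence the factor 6 = 3 * 2. *)
  have : (n ^ 2 <= 6 * num_surfaces (fun o : gluing n => in_H2 R o /\ has_unit_saddle R o))%N.
    by have := lower_quadratic n; nia.
  by rewrite -(ler_nat R) natrM natrX; lra.
rewrite -natrX -natrM ler_nat; apply: leq_trans (upper_quadratic n).
by apply: num_surfaces_le => o [/in_H2E h2 /unit_saddle_has_unit u].
Qed.
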